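(* Let $d\geq 1$ and let $\mathcal{C}$ be a $d$-arrangement of $k\geq 3$ curves in $\mathbb{P}^2_{\mathbb{C}}$ with $s$ intersection points. Let $\Bbbk$ be a field and let $I(G)\subset \Bbbk[x_1,\dots,x_s,y_1,\dots,y_k]$ be the edge ideal of the Levi graph $G$ of $\mathcal{C}$. Then the following conditions are equivalent: (i) $\Bbbk[x_1,\dots,x_s,y_1,\dots,y_k]/I(G)$ is sequentially Cohen-Macaulay; (ii) $\mathcal{C}$ is a pencil of $k$ lines in the plane (i.e. $d=1$ and all $k$ lines pass through a common point).
   Context: An arrangement $\mathcal{C}=\{C_1,\dots,C_k\}$ of $k\geq 3$ (distinct) curves in $\mathbb{P}^2_{\mathbb{C}}$ is a $d$-arrangement if all $C_i$ are smooth of the same degree $d\geq 1$ and all points of $\mathrm{Sing}(\mathcal{C})$ are ordinary intersection points, i.e. they look locally like intersections of lines (the curves through the point have pairwise distinct tangents there). Here $\mathrm{Sing}(\mathcal{C})$ is the set of intersection points, i.e. points lying on at least two curves of $\mathcal{C}$. Write $\mathrm{Sing}(\mathcal{C})=\{p_1,\dots,p_s\}$. The Levi graph $G$ of $\mathcal{C}$ is the bipartite graph with vertex set $\{x_1,\dots,x_s\}\cup\{y_1,\dots,y_k\}$ in which $x_j$ and $y_i$ are joined by an edge if and only if $p_j\in C_i$. Its edge ideal $I(G)$ is the ideal generated by all $x_jy_i$ such that $x_j$ and $y_i$ are adjacent. A graded module $M$ over a polynomial ring $S$ is sequentially Cohen-Macaulay if there is a finite filtration of graded $S$-modules $0=M_0\subset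 M_1\subset\dots\subset M_r=M$ such that each $M_i/M_{i-1}$ is Cohen-Macaulay and $\dim(M_1/M_0)<\dim(M_2/M_1)<\dots<\dim(M_r/M_{r-1})$. A quotient ring $S/I$ is sequentially Cohen-Macaulay if it is so as a graded $S$-module. *)

(* Defs.v *)
From HB Require Import structures.
From mathcomp Require Import all_boot all_order all_algebra.
From mathcomp Require Import boolp reals complex mpoly.

Set Implicit Arguments.
Unset Strict Implicit.
Unset Printing Implicit Defensive.

Import GRing.Theory.
Local Open Scope ring_scope.
Local Open Scope quotient_scope.

Section PlaneCurves.
Variable K : closedFieldType.

(* A point of P^2(K) is a line through the origin of K^3. *)
Definition proj_plane := {U : {vspace 'rV[K]_3} | \dim U == 1%N}.

Definition on_curve (f : {mpoly K[3]}) (p : proj_plane) : Prop :=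
  forall v, v \in val p -> f.@[v 0] = 0.

(* The Jacobian criterion for the homogeneous equation f. *)
Definition smooth_curve (d : nat) (f : {mpoly K[3]}) : Prop :=
  [/\ f != 0, f \is d.-homog &
      forall p, on_curve f p ->
        forall v, v \in val p -> v != 0 ->
          exists i : 'I_3, (f^`M(i)).@[v 0] != 0].

(* q lies on the projective tangent line of f at p, whose equation is
   \sum_i (df/dX_i)(p) X_i = 0. *)
Definition on_tangent (f : {mpoly K[3]}) (p q : proj_plane) : Prop :=
  forall v w, v \in val p -> w \in val q ->
    \sum_(i < 3) (f^`M(i)).@[v 0] * w 0 i = 0.

Definition same_tangent (f g : {mpoly K[3]}) (p : proj_plane) : Prop :=
  forall q, on_tangent f p q <-> on_tangent g p q.

(* Smooth plane curves are reduced, so they are distinct as curves when their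
   sets of points are. *)
Definition same_curve (f g : {mpoly K[3]}) : Prop :=
  forall p, on_curve f p <-> on_curve g p.

Definition intersection_point k (C : 'I_k -> {mpoly K[3]}) (p : proj_plane) :
    Prop :=
  exists i j, [/\ i != j, on_curve (C i) p & on_curve (C j) p].

Definition ordinary_at k (C : 'I_k -> {mpoly K[3]}) (p : proj_plane) : Prop :=
  forall i j, i != j -> on_curve (C i) p -> on_curve (C j) p ->
    ~ same_tangent (C i) (C j) p.

Record d_arrangement (d k : nat) (C : 'I_k -> {mpoly K[3]}) : Prop := {
  arr_degree : (1 <= d)%N;
  arr_size : (3 <= k)%N;
  arr_smooth : forall i, smooth_curve d (C i);
  arr_distinct : forall i j, i != j -> ~ same_curve (C i) (C j);
  arr_ordinary : forall p, intersection_point C p -> ordinary_at C p }.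

(* The vertices x_1, ..., x_s are the elements of 'I_(s + k) in the left
   summand, and y_1, ..., y_k those in the right one. *)
Definition levi_graph k s (C : 'I_k -> {mpoly K[3]}) (p : 'I_s -> proj_plane) :
    rel 'I_(s + k) :=
  fun u v =>
    match split u, split v with
    | inl j, inr i | inr i, inl j => `[< on_curve (C i) (p j) >]
    | _, _ => false
    end.

End PlaneCurves.

(* Submodules and ideals are boolean predicates; by asbool these are arbitrary
   subsets. *)

Section SubmoduleZmod.
Variables (S : pzRingType) (M : lmodType S) (N : submodClosed M).

(* N again: the library does not derive zmodClosed, which quotients and
   subtypes need, from submodClosed. *)
Definition zsubmod : {pred M} := fun x => x \in N.

Fact zsubmod_closed : subsemimod_closed zsubmod.
Proof.
split; last by move=> a x; exact: rpredZ.
by split=> [|x y]; [exact: rpred0 | exact: rpredD].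
Qed.

HB.instance Definition _ := GRing.isSubmodClosed.Build S M zsubmod
  zsubmod_closed.

End SubmoduleZmod.

Section SubmoduleType.
Variables (S : pzRingType) (M : lmodType S) (N : submodClosed M).

Record submod := Submod { submod_val :> M; _ : submod_val \in zsubmod N }.

HB.instance Definition _ := [isSub for submod_val].
HB.instance Definition _ := [Choice of submod by <:].
HB.instance Definition _ := [SubChoice_isSubLmodule of submod by <:].

End SubmoduleType.

Section QuotientModule.
Variables (S : pzRingType) (M : lmodType S) (N : submodClosed M).

Definition quotmod : Type := Quotient.quot (zsubmod N).

HB.instance Definition _ := GRing.Zmodule.on quotmod.

Definition quotmod_proj (x : M) : quotmod := \pi_(Quotient.quot (zsubmod N)) x.

Lemma quotmod_projB : zmod_morphism quotmod_proj.
Proof. by move=> x y; rewrite /quotmod_proj raddfB. Qed.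

HB.instance Definition _ := GRing.isZmodMorphism.Build M quotmod quotmod_proj
  quotmod_projB.

Lemma quotmod_projE x y : quotmod_proj x = quotmod_proj y <-> x - y \in N.
Proof.
rewrite -[_ \in N]/(x - y \in (zsubmod N : {pred M})).
by rewrite Quotient.idealrBE; split=> /eqP.
Qed.

Lemma quotmod_proj0 x : quotmod_proj x = 0 <-> x \in N.
Proof. by rewrite -(raddf0 quotmod_proj) quotmod_projE subr0. Qed.

Definition quotmod_repr (x : quotmod) : M := repr (x : Quotient.quot (zsubmod N)).

Lemma quotmod_reprK : cancel quotmod_repr quotmod_proj.
Proof. by move=> x; exact: (@reprK _ (Quotient.quot (zsubmod N)) x). Qed.

Definition quotmod_scale (a : S) (x : quotmod) : quotmod :=
  quotmod_proj (a *: quotmod_repr x).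

Lemma quotmod_proj_scale a x :
  quotmod_scale a (quotmod_proj x) = quotmod_proj (a *: x).
Proof.
apply/quotmod_projE; rewrite -scalerBr rpredZ //; apply/quotmod_projE.
exact: quotmod_reprK.
Qed.

Fact quotmod_scaleA a b x :
  quotmod_scale a (quotmod_scale b x) = quotmod_scale (a * b) x.
Proof.
by rewrite -[x]quotmod_reprK !quotmod_proj_scale scalerA.
Qed.

Fact quotmod_scale1 : left_id 1 quotmod_scale.
Proof. by move=> x; rewrite -[x]quotmod_reprK quotmod_proj_scale scale1r. Qed.

Fact quotmod_scaleDr : right_distributive quotmod_scale +%R.
Proof.
move=> a x y; rewrite -[x]quotmod_reprK -[y]quotmod_reprK -raddfD.
by rewrite !quotmod_proj_scale -raddfD scalerDr.
Qed.

Fact quotmod_scaleDl x : {morph quotmod_scale^~ x : a b / a + b}.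
Proof.
move=> a b; rewrite -[x]quotmod_reprK !quotmod_proj_scale -raddfD.
by rewrite scalerDl.
Qed.

HB.instance Definition _ := GRing.Zmodule_isLmodule.Build S quotmod
  quotmod_scaleA quotmod_scale1 quotmod_scaleDr quotmod_scaleDl.

Fact quotmod_projZ : scalable quotmod_proj.
Proof. by move=> a x; rewrite -quotmod_proj_scale. Qed.

HB.instance Definition _ := GRing.isScalable.Build S M quotmod *:%R
  quotmod_proj quotmod_projZ.

End QuotientModule.

(* N / L for submodules L <= N of M; for arbitrary L it is N / (N :&: L). *)

Section Subquotient.
Variables (S : pzRingType) (M : lmodType S) (N L : submodClosed M).

Definition restr_submod : {pred submod N} := fun x => val x \in L.

Fact restr_submod_closed : submod_closed restr_submod.
Proof.
have rE x : (x \in restr_submod) = (val x \in L) by [].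
split=> [|a x y]; rewrite !rE; first by rewrite raddf0 rpred0.
by move=> xL yL; rewrite linearP rpredD ?rpredZ.
Qed.

HB.instance Definition _ := GRing.isSubmodClosed.Build S (submod N)
  restr_submod restr_submod_closed.

Definition subquot : lmodType S := quotmod restr_submod.

End Subquotient.

Section Krull.
Variable S : comNzRingType.

Definition annihilates (M : lmodType S) (a : S) : Prop :=
  forall x : M, a *: x = 0.

(* idealr_closed includes properness. *)
Definition prime_ideal (P : {pred S}) : Prop :=
  idealr_closed P /\ prime_idealr_closed P.

Definition prime_chain (M : lmodType S) (l : nat) (P : nat -> {pred S}) :
    Prop :=
  (forall i, (i <= l)%N ->
     prime_ideal (P i) /\ (forall a, annihilates M a -> a \in P i)) /\
  (forall i, (i < l)%N ->
     {subset P i <= P i.+1} /\ (exists2 a, a \in P i.+1 & a \notin P i)).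

(* dim M = dim S / Ann M is the natural number d; this never holds for
   M = 0. *)
Definition krull_dim (M : lmodType S) (d : nat) : Prop :=
  (exists P, prime_chain M d P) /\
  (forall l P, prime_chain M l P -> (l <= d)%N).

(* Membership in (a_0, ..., a_(r-1)) M. *)
Definition in_ideal_mul (M : lmodType S) (a : seq S) (x : M) : Prop :=
  exists y : 'I_(size a) -> M, x = \sum_(i < size a) a`_i *: y i.

Definition regular_sequence (M : lmodType S) (a : seq S) : Prop :=
  (forall i, (i < size a)%N -> forall x : M,
     in_ideal_mul (take i a) (a`_i *: x) -> in_ideal_mul (take i a) x) /\
  (exists x : M, ~ in_ideal_mul a x).

Definition ideal_gen (A : S -> Prop) : {pred S^o} :=
  fun f => `[< exists (m : nat) (c g : 'I_m -> S),
    (forall i, A (g i)) /\ f = \sum_i c i * g i >].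

Fact ideal_gen_closed A : submod_closed (ideal_gen A).
Proof.
split=> [|a x y].
  by apply/asboolP; exists 0%N, (fun=> 0), (fun=> 0); split=> [[]|] //;
     rewrite big_ord0.
move=> /asboolP[m [c [g [Ag ->]]]] /asboolP[n [c' [g' [Ag' ->]]]].
apply/asboolP; exists (m + n)%N.
exists (fun i => match split i with inl j => a * c j | inr j => c' j end).
exists (fun i => match split i with inl j => g j | inr j => g' j end).
split=> [i|]; first by case: (split i).
rewrite big_split_ord /=; congr (_ + _).
  rewrite scaler_sumr; apply: eq_bigr => i _.
  by rewrite -[lshift _ _]/(unsplit (inl i)) unsplitK scalerAl.
by apply: eq_bigr => i _; rewrite -[rshift _ _]/(unsplit (inr i)) unsplitK.
Qed.

HB.instance Definition _ A := GRing.isSubmodClosed.Build S S^o (ideal_gen A)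
  (ideal_gen_closed A).

End Krull.

Section Graded.
Variables (n : nat) (F : fieldType).
Local Notation S := {mpoly F[n]}.

(* x is a finite sum of elements of N homogeneous for gr. *)
Definition sum_of_homog (M : lmodType S) (gr : int -> {pred M})
    (N : {pred M}) (x : M) : Prop :=
  exists (D : seq int) (u : int -> M),
    (forall d, u d \in gr d /\ u d \in N) /\ x = \sum_(d <- D) u d.

Record grading (M : lmodType S) := Grading {
  gr_piece :> int -> {pred M};
  gr_zmod : forall d, zmod_closed (gr_piece d);
  gr_scale : forall (e : nat) d (f : S) x,
    f \is e.-homog -> x \in gr_piece d -> f *: x \in gr_piece (e%:Z + d);
  gr_sum : forall x, sum_of_homog gr_piece predT x;
  gr_direct : forall (D : seq int) (u : int -> M), uniq D ->
    (forall d, u d \in gr_piece d) -> \sum_(d <- D) u d = 0 ->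
    {in D, forall d, u d = 0} }.

Definition graded_submod (M : lmodType S) (gr : grading M) (N : {pred M}) :
    Prop :=
  forall x, x \in N -> sum_of_homog gr N x.

(* depth M is the natural number d: the supremum of the lengths of M-regular
   sequences in the ideal (X_1, ..., X_n). *)
Definition depth (M : lmodType S) (d : nat) : Prop :=
  let reg a := all (fun f : S => f@_0%MM == 0) a /\ regular_sequence M a in
  (exists2 a, reg a & size a = d) /\ (forall a, reg a -> (size a <= d)%N).

Definition cohen_macaulay (M : lmodType S) : Prop :=
  exists2 d, krull_dim M d & depth M d.

Definition sequentially_CM (M : lmodType S) (gr : grading M) : Prop :=
  exists (r : nat) (N : nat -> submodClosed M),
    [/\ N 0%N =i pred1 0, N r =i predT,
        forall i, (i <= r)%N -> graded_submod gr (N i),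
        forall i, (i < r)%N -> {subset N i <= N i.+1} /\
          cohen_macaulay (subquot (N i.+1) (N i)) &
        forall i, (i.+1 < r)%N -> exists d e,
          [/\ krull_dim (subquot (N i.+1) (N i)) d,
              krull_dim (subquot (N i.+2) (N i.+1)) e & (d < e)%N]].

Section QuotientGrading.
Variable I : submodClosed S^o.

Definition homogeneous_ideal : Prop :=
  forall (d : nat) (f : S), f \in I -> (pihomog mdeg d f : S^o) \in I.

(* The classes of the homogeneous polynomials of degree d; only the class 0
   for d < 0. *)
Definition quot_piece (d : int) : {pred quotmod I} :=
  fun x => `[< exists f : S,
    (forall m, m \in msupp f -> (mdeg m)%:Z = d) /\ x = quotmod_proj I f >].

Fact quot_piece_zmod d : zmod_closed (quot_piece d).
Proof.
split=> [|_ _ /asboolP[f [hf ->]] /asboolP[g [hg ->]]]; apply/asboolP.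
  by exists 0; split=> [m|]; rewrite ?msupp0 ?raddf0.
exists (f - g); split=> [m /msuppB_le|]; last by rewrite raddfB.
by rewrite mem_cat => /orP[/hf|/hg].
Qed.

Fact quot_piece_scale (e : nat) d (f : S) x :
  f \is e.-homog -> x \in quot_piece d -> f *: x \in quot_piece (e%:Z + d).
Proof.
move=> /dhomogP hf /asboolP[g [hg ->]]; apply/asboolP; exists (f * g).
split=> [m|]; last by rewrite -linearZ.
move=> /msuppM_le/allpairsP[[m1 m2] /= [/hf h1 /hg h2 ->]].
by rewrite mdegD PoszD h2; move: h1 => /= ->.
Qed.

Fact quot_piece_sum x : sum_of_homog quot_piece predT x.
Proof.
pose f : S := quotmod_repr x.
exists (map Posz (iota 0 (msize f))).
exists (fun d => if d is Posz e then quotmod_proj I (pihomog mdeg e f) else 0).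
split=> [d|].
  split=> //; case: d => e; last by case: (quot_piece_zmod (Negz e)).
  apply/asboolP; exists (pihomog mdeg e f); split=> // m.
  by move/(dhomog_mf (pihomogP mdeg e f)) => ->.
rewrite big_map (_ : iota 0 _ = index_iota 0 (msize f)); last first.
  by rewrite /index_iota subn0.
rewrite big_mkord -raddf_sum.
by rewrite -(pihomog_partitionE (leqnn _)); exact: esym (quotmod_reprK x).
Qed.

Hypothesis homI : homogeneous_ideal.

Fact quot_piece_direct (D : seq int) (u : int -> quotmod I) : uniq D ->
  (forall d, u d \in quot_piece d) -> \sum_(d <- D) u d = 0 ->
  {in D, forall d, u d = 0}.
Proof.
move=> uD hu; have {hu} /choice[f hf] : forall d, exists f : S,
    (forall m, m \in msupp f -> (mdeg m)%:Z = d) /\ u d = quotmod_proj I f.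
  by move=> d; exact/asboolP/(hu d).
rewrite (eq_bigr (fun d => quotmod_proj I (f d))) => [|d _]; last by case: (hf d).
rewrite -raddf_sum => /quotmod_proj0 fI d dD.
have [hd ->] := hf d; apply/quotmod_proj0.
case: d dD hd => e dD hd; last first.
  have -> : f (Negz e) = 0.
    by apply/eqP; rewrite -msupp_eq0; case: msupp hd => // m s /(_ m (mem_head _ _)).
  exact: rpred0.
have := homI e fI; rewrite raddf_sum (bigD1_seq (Posz e)) //= big1 ?addr0.
  rewrite pihomog_dE //; by apply/dhomogP => m /hd [].
move=> d' ne; rewrite pihomogE big_seq_cond big_pred0 // => m.
apply/negP => /andP[/(proj1 (hf d')) h /eqP h2].
by move: ne; rewrite -h -h2 eqxx.
Qed.

Definition quot_grading : grading (quotmod I) :=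
  Grading quot_piece_zmod quot_piece_scale quot_piece_sum quot_piece_direct.

End QuotientGrading.

Section EdgeIdeal.
Variable e : rel 'I_n.

Definition edge_monomial (f : S) : Prop := exists u v, e u v /\ f = 'X_u * 'X_v.

Definition edge_ideal := ideal_gen edge_monomial.

Lemma edge_ideal_homog : homogeneous_ideal edge_ideal.
Proof.
move=> d f /asboolP[m [c [g [gE ->]]]]; rewrite raddf_sum /=.
apply: (@rpred_sum S^o) => i _; have [u [v [euv ->]]] := gE i.
rewrite [c i]mpolyE mulr_suml raddf_sum /=; apply: (@rpred_sum S^o) => p _.
rewrite -scalerAl linearZ /= -!mpolyXD pihomogX -mul_mpolyC.
apply: (@rpredZ _ S^o); case: ifP => _; last exact: (@rpred0 S^o).
apply/asboolP; exists 1%N, (fun=> 'X_[p]), (fun=> 'X_u * 'X_v).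
by split=> [_|]; [exists u, v | rewrite big_ord1 !mpolyXD].
Qed.

Definition edge_grading : grading (quotmod edge_ideal) :=
  quot_grading edge_ideal_homog.

End EdgeIdeal.

End Graded.

(* Main.v *)
Require Import Defs.
From HB Require Import structures.
From mathcomp Require Import all_boot all_order all_algebra.
From mathcomp Require Import ring.
From mathcomp Require Import boolp reals complex mpoly.

Set Implicit Arguments.
Unset Strict Implicit.
Unset Printing Implicit Defensive.

Import GRing.Theory.
Local Open Scope ring_scope.

(** That a sequentially Cohen-Macaulay Levi graph comes from a pencil of lines rests on
    a fact of commutative algebra: a bipartite graph without isolated vertices whose
    edge ideal I is sequentially Cohen-Macaulay has a vertex of degree one. In a
    Levi graph a point vertex never has degree one, since an intersection point lies
    on two curves. A curve vertex has degree one only for a pencil of lines: two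
    smooth curves of degree at least 2 that cross transversally have two common
    points, and a line with a single intersection point meets all the other lines
    there. Conversely, in a pencil of lines there is one intersection point, because
    two distinct lines meet only once; the graph is then a star, whose edge ideal is
    sequentially Cohen-Macaulay.

    A vertex of degree one ([leafless_not_SCM]). Let A and B be the two sides, with
    m = #|A| <= #|B|, and suppose that each vertex of B has two neighbours in A. The
    primes (A) and (B) contain I, and their quotients have dimension #|B| and m,
    both at least m. Cut the Cohen-Macaulay filtration of S / I where the dimensions
    of its quotients reach m. This gives an ideal L containing I such that S / L has
    depth at least m in the strong form that its Koszul cohomology vanishes below
    degree m, and L is still contained in both primes, by the definition of
    dimension through chains of primes ([sequentially_CM_truncation]). Deleting one
    variable from the Koszul complex costs one degree of vanishing ([kvanish_drop],
    a graded Nakayama argument), so for W in A with #|W| <= m - 2 a family of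
    elements n_v, v not in W, that is compatible as if n_v = X_v h does come from
    such an h modulo L. The monomials X_W, W in A with #|W| = m - 1, are killed by B
    modulo I, because W misses only one vertex of A. Descending from them by this
    extension principle to W empty produces h with B h in L and h = 1 modulo (B). In
    degree one, this forces B into L, hence into (A), which is absurd. This is the
    statement that a Cohen-Macaulay scheme is connected in codimension one, applied
    to the facet A of the independence complex, which shares no m - 1 vertices with
    any other face of at least m vertices.

    Stars ([star_SCM]). With centre c, the filtration 0, (X_c) / I, S / I has the
    quotients S / (leaves), up to a shift, and S / (X_c). For a monomial prime (W)
    the dimension of S / (W) is bounded above by the algebraic dependence of more
    than n - #|W| polynomials ([prime_chain_le]), and its depth by the same two
    facts on Koszul cohomology, since 1 is killed by W ([cyclic_depth]).

    Two common points ([two_common_zeros]). Let f and g of degree d >= 2 have at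
    most one common point P, crossing transversally there, and let X_z be a
    coordinate with P off the line X_z = 0. In the affine chart, the ideal of the h
    with (x - a) h in (f, g), where a is the first coordinate of P, has no zero: the
    only candidate is P, and by Cramer's rule the ideal contains a polynomial whose
    value at P is the Jacobian determinant. By a Nullstellensatz
    ([nullstellensatz]), which needs a univariate polynomial in (f, g), supplied by
    the resultant, x - a lies in (f, g). Homogenized, X_z ^ N (X_x - a X_z) is in
    (f, g). As f and g have no common zero on the line X_z = 0, X_z is not a zero
    divisor modulo (f, g) ([zdivisor]), so the linear form X_x - a X_z is in (f, g);
    but (f, g) starts in degree d >= 2. *)

(** * Koszul cohomology of a pair of submodules *)

Section Koszul.
Variables (S : comNzRingType) (M : lmodType S).
Implicit Types (zs : seq S) (f g : seq bool -> M) (A B C : M -> Prop).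

(** Submodules as mere predicates, for which kernels, preimages and colons need no
    structure instances. *)
Definition is_submod A := A 0 /\ forall a x y, A x -> A y -> A (a *: x + y).

Lemma is_submodD A x y : is_submod A -> A x -> A y -> A (x + y).
Proof. by case=> _ h Ax Ay; rewrite -[x]scale1r; apply: h. Qed.

Lemma is_submodZ A a x : is_submod A -> A x -> A (a *: x).
Proof. by case=> h0 h Ax; rewrite -[_ *: _]addr0; apply: h. Qed.

Lemma is_submodB A x y : is_submod A -> A x -> A y -> A (x - y).
Proof.
by move=> hA Ax Ay; apply: is_submodD => //; rewrite -scaleN1r; apply: is_submodZ.
Qed.

Lemma is_submod_sum A I (r : seq I) (P : pred I) (E : I -> M) :
  is_submod A -> (forall i, P i -> A (E i)) -> A (\sum_(i <- r | P i) E i).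
Proof.
by move=> hA hE; apply: big_ind => //; [case: hA | move=> x y; apply: is_submodD].
Qed.

(** The cochain Koszul complex of zs with coefficients in M. A cochain assigns an
    element of M to each word of booleans, which says for each z in zs whether the
    corresponding exterior generator occurs; only words of length size zs are
    meaningful. The complex of z :: zs is the mapping cone of z on the complex of
    zs. *)
Fixpoint kdiff zs f (w : seq bool) {struct zs} : M :=
  match zs, w with
  | z :: zs', true :: w' =>
      z *: f (false :: w') - kdiff zs' (fun v => f (true :: v)) w'
  | z :: zs', false :: w' => kdiff zs' (fun v => f (false :: v)) w'
  | _, _ => 0
  end.

Lemma kdiff_linear zs a f g w :
  kdiff zs (fun v => a *: f v + g v) w = a *: kdiff zs f w + kdiff zs g w.
Proof.
elim: zs f g w => [|z zs IH] f g [|[] w] /=; rewrite ?scaler0 ?addr0 //.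
rewrite (IH (fun v => f (true :: v)) (fun v => g (true :: v))).
by rewrite scalerDr !scalerBr !scalerA mulrC opprD addrACA.
Qed.

Lemma kdiff0 zs w : kdiff zs (fun=> 0) w = 0.
Proof.
elim: zs w => [|z zs IH] [|[] w] //=.
by rewrite IH scaler0 subr0.
Qed.

Lemma kdiffZ zs a f w : kdiff zs (fun v => a *: f v) w = a *: kdiff zs f w.
Proof.
rewrite -[RHS]addr0 -(kdiff0 zs w) -kdiff_linear.
by congr (kdiff zs _ w); apply/funext => v; rewrite addr0.
Qed.

Lemma kdiffD zs f g w :
  kdiff zs (fun v => f v + g v) w = kdiff zs f w + kdiff zs g w.
Proof.
rewrite -[kdiff zs f w]scale1r -kdiff_linear.
by congr (kdiff zs _ w); apply/funext => v; rewrite scale1r.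
Qed.

Lemma kdiffB zs f g w :
  kdiff zs (fun v => f v - g v) w = kdiff zs f w - kdiff zs g w.
Proof.
rewrite -scaleN1r -kdiffZ -kdiffD.
by congr (kdiff zs _ w); apply/funext => v; rewrite scaleN1r.
Qed.

Lemma kdiff_sum zs I (r : seq I) (E : I -> seq bool -> M) w :
  kdiff zs (fun v => \sum_(i <- r) E i v) w = \sum_(i <- r) kdiff zs (E i) w.
Proof.
elim: r => [|i r IH].
  rewrite big_nil; apply: etrans (kdiff0 zs w); congr (kdiff zs _ w).
  by apply/funext => v; rewrite big_nil.
rewrite big_cons -IH -kdiffD; congr (kdiff zs _ w).
by apply/funext => v; rewrite big_cons.
Qed.

Lemma eq_kdiff zs f g w : size w = size zs ->
  (forall v, size v = size zs -> f v = g v) -> kdiff zs f w = kdiff zs g w.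
Proof.
elim: zs f g w => [|z zs IH] f g [|[] w] //= [sw] h.
  rewrite h /= ?sw //; congr (_ - _).
  by apply: IH => // v sv; apply: h; rewrite /= sv.
by apply: IH => // v sv; apply: h; rewrite /= sv.
Qed.

Lemma kdiff_in A zs f w : is_submod A -> (forall v, A (f v)) -> A (kdiff zs f w).
Proof.
move=> hA; elim: zs f w => [|z zs IH] f [|[] w] Af /=; try by case: hA.
  by apply: is_submodB => //; [apply: is_submodZ | apply: IH].
exact: IH.
Qed.

Lemma kdiff_in_size A zs f w : is_submod A -> size w = size zs ->
  (forall v, size v = size zs -> A (f v)) -> A (kdiff zs f w).
Proof.
move=> hA sw Af.
rewrite (eq_kdiff (g := fun v => if size v == size zs then f v else 0)) // => [|v ->].
  by apply: kdiff_in => // v; case: eqP => [/Af|] //; case: hA.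
by rewrite eqxx.
Qed.

Lemma kdiffK zs f w : kdiff zs (kdiff zs f) w = 0.
Proof.
elim: zs f w => [|z zs IH] f [|[] w] //=.
by rewrite kdiffB kdiffZ IH subr0 subrr.
Qed.

(** f is homogeneous of cohomological degree i - 1; for i = 0 this means f = 0. *)
Definition kdegp i f := forall w, (count id w).+1 <> i -> f w = 0.
Definition kdeg i f := kdegp i.+1 f.

Lemma kdiff_deg zs i f : kdegp i f -> kdeg i (kdiff zs f).
Proof.
elim: zs i f => [|z zs IH] i f hf [|[] w] //= hw.
  rewrite hf ?scaler0 ?sub0r /= => [|e]; last by apply: hw; rewrite -e add0n.
  case: i hf hw => [|i] hf hw.
    rewrite (_ : (fun v => _) = (fun=> 0)) ?kdiff0 ?oppr0 //.
    by apply/funext => v; rewrite hf.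
  rewrite (IH i) ?oppr0 // => [v hv|e]; last by apply: hw; rewrite -e add1n.
  by apply: hf => -[]; rewrite /= add1n.
by apply: (IH i) => // v hv; apply: hf.
Qed.

(** Contraction with the k-th exterior generator. *)
Fixpoint khtpy k f (w : seq bool) {struct k} : M :=
  match k, w with
  | 0, false :: w' => f (true :: w')
  | k'.+1, false :: w' => khtpy k' (fun v => f (false :: v)) w'
  | k'.+1, true :: w' => - khtpy k' (fun v => f (true :: v)) w'
  | _, _ => 0
  end.

Lemma khtpy_linear k a f g w :
  khtpy k (fun v => a *: f v + g v) w = a *: khtpy k f w + khtpy k g w.
Proof.
elim: k f g w => [|k IH] f g [|[] w] /=; rewrite ?scaler0 ?addr0 ?oppr0 //.
rewrite (IH (fun v => f (true :: v)) (fun v => g (true :: v))).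
by rewrite opprD scalerN.
Qed.

Lemma khtpy0 k w : khtpy k (fun=> 0) w = 0.
Proof.
elim: k w => [|k IH] [|[] w] //=; by rewrite ?IH ?oppr0.
Qed.

Lemma khtpyB k a f g w :
  khtpy k (fun v => a *: f v - g v) w = a *: khtpy k f w - khtpy k g w.
Proof.
have -> : (fun v => a *: f v - g v) = (fun v => (-1) *: g v + (a *: f v + 0)).
  by apply/funext => v; rewrite scaleN1r addrC addr0.
by rewrite 2!khtpy_linear khtpy0 addr0 scaleN1r addrC.
Qed.

Lemma khtpy_in A k f w : is_submod A -> (forall v, A (f v)) -> A (khtpy k f w).
Proof.
move=> hA; elim: k f w => [|k IH] f [|[] w] Af //=; try by case: hA.
  by rewrite -scaleN1r; apply: is_submodZ => //; apply: IH.
exact: IH.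
Qed.

Lemma khtpy_in_size A k f n w : is_submod A -> size w = n -> (k < n)%N ->
  (forall v, size v = n -> A (f v)) -> A (khtpy k f w).
Proof.
move=> hA; elim: k n f w => [|k IH] [|n] f [|[] w] //= [sw] hk Af; try by case: hA.
- by apply: Af; rewrite /= sw.
- rewrite -scaleN1r; apply: is_submodZ => //; apply: (IH n) => // v sv.
  by apply: Af; rewrite /= sv.
- by apply: (IH n) => // v sv; apply: Af; rewrite /= sv.
Qed.

Lemma khtpy_deg k i f : kdeg i f -> kdegp i (khtpy k f).
Proof.
elim: k i f => [|k IH] i f hf [|[] w] //= hw;
  first by apply: hf => -[/= e]; apply: hw; rewrite -e.
  case: i hf hw => [|i] hf hw.
    rewrite (_ : (fun v => _) = (fun=> 0)) ?khtpy0 ?oppr0 //.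
    by apply/funext => v; rewrite hf.
  rewrite (IH i) ?oppr0 // => [v hv|e]; last by apply: hw; rewrite -e add1n.
  by apply: hf => -[e]; apply: hv; rewrite -e.
by apply: (IH i) => // v hv; apply: hf.
Qed.

(** Multiplication by an element of zs is homotopic to zero: this is why the ideal
    generated by zs annihilates the Koszul cohomology. *)
Lemma khtpyP zs k f w : size w = size zs -> (k < size zs)%N ->
  kdiff zs (khtpy k f) w + khtpy k (kdiff zs f) w = zs`_k *: f w.
Proof.
elim: k zs f w => [|k IH] [|z zs] f [|[] w] //= [sw] hk.
- by rewrite kdiff0 subr0 addr0.
- by rewrite addrC subrK.
- rewrite (_ : (fun v => - _) = (fun v => (-1) *: khtpy k (fun u => f (true :: u)) v)).
    rewrite kdiffZ scaleN1r opprK khtpyB opprB -(IH zs (fun v => f (true :: v))) //.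
    by rewrite [z *: _ + _]addrC addrACA subrr addr0.
  by apply/funext => v; rewrite scaleN1r.
- exact: IH.
Qed.

(** The i-th Koszul cohomology of A / B vanishes. Cochains stay in A and are
    compared modulo B, which avoids quotient modules. *)
Definition kvanish zs A B i := forall f, (forall w, A (f w)) -> kdeg i f ->
  (forall w, size w = size zs -> B (kdiff zs f w)) ->
  exists g, [/\ forall w, A (g w), kdegp i g &
    forall w, size w = size zs -> B (f w - kdiff zs g w)].

(** The exact cohomology sequence of 0 -> B / C -> A / C -> A / B -> 0: a cocycle of
    A / C has a primitive up to an error in B, and that error has a primitive. *)
Lemma kvanish_trans zs A B C i : is_submod A -> is_submod B ->
  (forall x, B x -> A x) -> (forall x, C x -> B x) ->
  kvanish zs A B i -> kvanish zs B C i -> kvanish zs A C i.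
Proof.
move=> hA hB sBA sCB vAB vBC f Af df Df.
have [|g [Ag dg hg]] := vAB f Af df; first by move=> w sw; apply: sCB; apply: Df.
pose f' w := if size w == size zs then f w - kdiff zs g w else 0.
have [w||w sw|h [Bh dh hh]] := vBC f'.
- by rewrite /f'; case: eqP => [/hg|_] //; case: hB.
- move=> w hw; rewrite /f'; case: eqP => // sw.
  by rewrite df // (kdiff_deg zs dg) // subr0.
- rewrite (eq_kdiff (g := fun v => f v - kdiff zs g v)) // => [|v sv].
    by rewrite kdiffB kdiffK subr0; apply: Df.
  by rewrite /f' sv eqxx.
exists (fun w => g w + h w); split=> [w|w hw|w sw].
- by apply: is_submodD => //; apply: sBA.
- by rewrite dg // dh // addr0.
- by rewrite kdiffD opprD addrA; have := hh w sw; rewrite /f' sw eqxx.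
Qed.

Lemma kvanish_refl zs A i : is_submod A -> kvanish zs A A i.
Proof.
move=> hA f Af _ _; exists (fun=> 0); split=> // [_|w sw]; first by case: hA.
by rewrite kdiff0 subr0.
Qed.

(** Let a be in the ideal of zs and regular on A / B. If f is a cocycle, a f is the
    coboundary of some h, by homotopy; so h is a cocycle modulo B' = B + a A, and up
    to coboundaries it is a multiple a u. Dividing by a, u is a primitive of f. *)
Lemma kvanish_regular zs A B B' (c : nat -> S) a i :
  is_submod A -> is_submod B -> (forall x, B x -> A x) ->
  a = \sum_(k < size zs) c k * zs`_k ->
  (forall x, B' x <-> A x /\ exists2 u, A u & B (x - a *: u)) ->
  (forall x, A x -> B (a *: x) -> B x) ->
  (forall j, j.+1 = i -> kvanish zs A B' j) -> kvanish zs A B i.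
Proof.
move=> hA hB sBA aE B'P reg vB' f Af df Df.
pose h w := \sum_(k < size zs) c k *: khtpy k f w.
have Ah w : A (h w).
  apply: is_submod_sum => // k _; apply: is_submodZ => //; exact: khtpy_in.
have dh : kdegp i h.
  by move=> w hw; rewrite /h big1 // => k _; rewrite (khtpy_deg _ df) ?scaler0.
have hE w : size w = size zs -> B (a *: f w - kdiff zs h w).
  move=> sw; rewrite aE scaler_suml kdiff_sum -sumrB.
  apply: is_submod_sum => // k _; rewrite kdiffZ -scalerA -scalerBr -khtpyP //.
  apply: is_submodZ => //; rewrite addrAC subrr add0r.
  by apply: (khtpy_in_size (n := size zs)).
case: i df dh vB' => [|j] df dh vB'.
  exists (fun=> 0); split=> // [_|w sw]; first by case: hA.
  rewrite kdiff0 subr0; apply: reg => //.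
  have -> : a *: f w = a *: f w - kdiff zs h w; last exact: hE.
  rewrite (_ : h = fun=> 0) ?kdiff0 ?subr0 //; apply/funext => v; exact: dh.
have [w sw|g [Ag dg hg]] := vB' j erefl h Ah dh.
  apply/B'P; split; first exact: kdiff_in.
  exists (f w); first exact: Af.
  by rewrite -opprB -scaleN1r; apply: is_submodZ => //; apply: hE.
have /choice[u hu] : forall w, exists u, [/\ A u,
    size w = size zs -> count id w = j -> B (h w - kdiff zs g w - a *: u) &
    (size w <> size zs \/ count id w <> j) -> u = 0].
  move=> w; have [sw|sw] := eqVneq (size w) (size zs); last first.
    by exists 0; split=> [|e|] //; [case: hA | rewrite e eqxx in sw].
  have [cw|cw] := eqVneq (count id w) j; last first.
    by exists 0; split=> [|_ e|] //; [case: hA | rewrite e eqxx in cw].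
  have /B'P[_ [u Au hu]] := hg w sw.
  by exists u; split=> // -[].
have Au w : A (u w) by case: (hu w).
have du : kdegp j.+1 u.
  by move=> w hw; case: (hu w) => _ _; apply; right=> e; apply: hw; rewrite e.
exists u; split=> // w sw; apply: reg.
  by apply: is_submodB => //; apply: kdiff_in.
pose b w := h w - kdiff zs g w - a *: u w.
have Bb v : size v = size zs -> B (b v).
  move=> sv; have [cv|/eqP cv] := eqVneq (count id v) j;
    first by case: (hu v) => _ h1 _; apply: h1.
  have cv' : (count id v).+1 <> j.+1 by move=> [].
  by rewrite /b dh // (kdiff_deg zs dg) // du // scaler0 !subr0; case: hB.
have DbE : kdiff zs b w = kdiff zs h w - a *: kdiff zs u w.
  by rewrite /b 2!kdiffB kdiffZ kdiffK subr0.
rewrite scalerBr -[a *: f w](subrK (kdiff zs h w)) -addrA -DbE.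
by apply: is_submodD => //; [apply: hE | apply: kdiff_in_size].
Qed.

End Koszul.

(** * Monomial primes and homogeneous components *)

Section Kill.
Variables (n : nat) (F : fieldType).
Local Notation S := {mpoly F[n]}.
Implicit Types (f g : S) (W V : {set 'I_n}) (m : 'X_{1..n}).

Lemma mcoeff_pihomog e f m :
  (pihomog mdeg e f)@_m = if mdeg m == e then f@_m else 0.
Proof.
elim/mpolyind: f => [|c m' p _ _ IH]; first by rewrite pihomog0 !mcoeff0 if_same.
rewrite pihomogD linearZ /= pihomogX !mcoeffD !mcoeffZ IH mcoeffX.
have [<-|ne] := eqVneq m' m;
  first by case: ifP => _; rewrite ?mcoeffX ?eqxx ?mcoeff0 ?mulr0 ?addr0.
by case: ifP => _; case: ifP => _; rewrite ?mcoeffX ?(negPf ne) ?mcoeff0 ?mulr0 ?addr0.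
Qed.

Lemma pihomog_Xmul e v f : pihomog mdeg e.+1 ('X_v * f) = 'X_v * pihomog mdeg e f.
Proof.
elim/mpolyind: f => [|c m p _ _ IH]; first by rewrite pihomog0 mulr0 pihomog0.
rewrite mulrDr !pihomogD mulrDr IH; congr (_ + _).
rewrite -scalerAr -mpolyXD !linearZ /= !pihomogX /= mdegD mdeg1 add1n eqSS.
by case: ifP => _; rewrite -scalerAr ?mulr0 // mpolyXD.
Qed.

Lemma pihomog0_Xmul v f : pihomog mdeg 0 ('X_v * f) = 0.
Proof.
elim/mpolyind: f => [|c m p _ _ IH]; first by rewrite mulr0 pihomog0.
rewrite mulrDr pihomogD IH addr0 -scalerAr -mpolyXD linearZ /= pihomogX /= mdegD.
by rewrite mdeg1 scaler0.
Qed.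

(** The substitution of 0 for the variables of W. Its kernel is the prime ideal
    generated by W; as a kernel it is visibly prime. *)
Definition kill W f : S := f \mPo [tuple if v \in W then 0 else 'X_v | v < n].

HB.instance Definition _ W := GRing.RMorphism.copy (kill W)
  (comp_mpoly [tuple if v \in W then 0 else 'X_v | v < n]).
HB.instance Definition _ W := GRing.Linear.copy (kill W)
  (comp_mpoly [tuple if v \in W then 0 else 'X_v | v < n]).

Lemma killX W m :
  kill W 'X_[m] = if [forall v in W, m v == 0%N] then 'X_[m] else 0.
Proof.
rewrite /kill comp_mpolyX; case: ifP => [/forall_inP h|/forall_inPn[v vW mv]].
  rewrite mpolyXE_id; apply: eq_bigr => i _; rewrite tnth_mktuple.
  by case: ifP => // /h /eqP ->; rewrite !expr0.
by rewrite (bigD1 v) //= tnth_mktuple vW expr0n (negPf mv) mul0r.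
Qed.

Lemma killU W v : kill W 'X_v = if v \in W then 0 else 'X_v.
Proof.
rewrite killX; case: (boolP (v \in W)) => vW; case: ifP => //.
  by move/forall_inP/(_ v vW); rewrite mnm1E eqxx.
move=> /forall_inPn[w wW]; rewrite mnm1E eqb0 negbK => /eqP e.
by rewrite e wW in vW.
Qed.

Lemma mcoeff_kill W f m :
  (kill W f)@_m = if [forall v in W, m v == 0%N] then f@_m else 0.
Proof.
elim/mpolyind: f => [|c m' p _ _ IH]; first by rewrite raddf0 !mcoeff0 if_same.
rewrite raddfD /= linearZ /= !mcoeffD !mcoeffZ IH killX mcoeffX.
have [<-|ne] := eqVneq m' m;
  first by case: ifP => _; rewrite ?mcoeffX ?eqxx ?mcoeff0 ?mulr0 ?addr0.
by case: ifP => _; case: ifP => _; rewrite ?mcoeffX ?(negPf ne) ?mcoeff0 ?mulr0 ?addr0.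
Qed.

Lemma kill_kill W V f : kill W (kill V f) = kill (W :|: V) f.
Proof.
apply/mpolyP => m; rewrite !mcoeff_kill.
case: ifP => [/forall_inP hW|/forall_inPn[v vW mv]]; last first.
  case: ifP => // /forall_inP/(_ v); rewrite inE vW (negPf mv).
  by move/(_ isT).
case: ifP => [/forall_inP hV|/forall_inPn[v vW mv]]; last first.
  by case: ifP => // /forall_inP/(_ v); rewrite inE vW orbT (negPf mv) => /(_ isT).
case: ifP => // /forall_inPn[v]; rewrite inE => /orP[/hW|/hV] /eqP ->; by rewrite eqxx.
Qed.

Lemma pihomog_kill W e f : pihomog mdeg e (kill W f) = kill W (pihomog mdeg e f).
Proof.
by apply/mpolyP => m; rewrite !(mcoeff_pihomog, mcoeff_kill); do 2 case: ifP.
Qed.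

(** Hence the kernel of kill W is the ideal generated by the variables of W. *)
Lemma kill_sub W f : exists g : 'I_n -> S, f - kill W f = \sum_(v in W) g v * 'X_v.
Proof.
elim/mpolyind: f => [|c m p _ _ [g hg]].
  by exists (fun=> 0); rewrite raddf0 subr0 big1 // => v _; rewrite mul0r.
rewrite raddfD /= linearZ /= opprD addrACA hg killX.
case: ifP => [_|/forall_inPn[v vW mv]]; first by exists g; rewrite subrr add0r.
exists (fun w => (if w == v then c *: 'X_[m - U_(v)] else 0) + g w).
rewrite (eq_bigr _ (fun w _ => mulrDl _ _ _)) big_split /=; congr (_ + _).
rewrite scaler0 subr0 (bigD1 v) //= eqxx big1 ?addr0 => [|w /andP[_ /negPf ->]];
  last by rewrite mul0r.
by rewrite -scalerAl -mpolyXD submK // lep1mP.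
Qed.

Lemma mcoeff0_sumX f : f@_0%MM = 0 -> exists g : 'I_n -> S, f = \sum_v g v * 'X_v.
Proof.
move=> f0; have [g hg] := kill_sub setT f; exists g.
have k0 : kill setT f = 0.
  apply/mpolyP => m; rewrite mcoeff0 mcoeff_kill; case: ifP => // /forall_inP h.
  rewrite (_ : m = 0%MM) ?f0 //; apply/mnmP => v; rewrite mnm0E; apply/eqP/h.
  by rewrite inE.
move: hg; rewrite k0 subr0 => ->; apply: eq_bigl => v; by rewrite inE.
Qed.

(** The kernel of kill W in the form used by prime chains. *)
Definition killed_by W : {pred S} := fun f => kill W f == 0.

Lemma killed_prime W : prime_ideal (killed_by W).
Proof.
split; last first.
  move=> u v; rewrite -!topredE /= /killed_by rmorphM /= mulf_eq0; exact.
split; rewrite -?topredE /= /killed_by ?raddf0 ?eqxx ?rmorph1 ?oner_eq0 //.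
move=> a u v; rewrite -!topredE /= /killed_by => /eqP hu /eqP hv.
by rewrite raddfD /= rmorphM /= hu hv mulr0 addr0.
Qed.

Lemma killed_submod W : is_submod (fun f : S^o => kill W f = 0).
Proof.
split=> [|a x y hx hy]; first by rewrite raddf0.
by rewrite raddfD /= [a *: x]/(a * x) rmorphM /= hx hy mulr0 addr0.
Qed.

End Kill.

(** * Deleting a variable from the Koszul complex *)

Section Drop.
Variables (n : nat) (F : fieldType).
Local Notation S := {mpoly F[n]}.
Implicit Types (A B : S^o -> Prop) (s : seq 'I_n).

Definition vars s : seq S := [seq 'X_v | v <- s].

Definition is_homog A := forall e (x : S), A x -> A (pihomog mdeg e x).

Lemma pihomog_kdiff e s (f : seq bool -> S^o) w :
  pihomog mdeg e.+1 (kdiff (vars s) f w : S) =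
  kdiff (vars s) (fun v => pihomog mdeg e (f v : S) : S^o) w.
Proof.
elim: s f w => [|v s IH] f [|[] w] //=; rewrite ?pihomog0 //.
by rewrite raddfB /= pihomog_Xmul IH.
Qed.

Lemma pihomog0_kdiff s (f : seq bool -> S^o) w :
  pihomog mdeg 0 (kdiff (vars s) f w : S) = 0.
Proof.
elim: s f w => [|v s IH] f [|[] w] //=; rewrite ?pihomog0 //.
by rewrite raddfB /= pihomog0_Xmul IH subrr.
Qed.

(** In the cohomology sequence of the mapping cone, X_v is surjective on H^i (s) as
    soon as H^(i+1) (v :: s) vanishes. Since all degrees are nonnegative, Nakayama's
    lemma holds without finiteness: a cocycle of internal degree e is X_v times a
    cocycle of internal degree e - 1, up to a coboundary. *)
Lemma kvanish_drop v s A B i :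
  is_submod A -> is_submod B -> is_homog A -> is_homog B ->
  kvanish (vars (v :: s)) A B i.+1 -> kvanish (vars s) A B i.
Proof.
move=> hA hB gA gB vAB.
(* Cocycles with entries of internal degree e, to which the induction on e applies. *)
have piece e : forall f : seq bool -> S^o, (forall w, A (f w)) -> kdeg i f ->
  (forall w, pihomog mdeg e (f w : S) = f w) ->
  (forall w, size w = size (vars s) -> B (kdiff (vars s) f w)) ->
  exists g, [/\ forall w, A (g w), kdegp i g &
    forall w, size w = size (vars s) -> B (f w - kdiff (vars s) g w)].
  elim: e => [|e IH] f Af df fe Df;
    (pose f1 w := if w is true :: w' then f w' else 0;
     have [| | |G [AG dG hG]] := vAB f1;
     [ by move=> [|[] w] //=; case: hA
     | by move=> [|[] w] //= hw; apply: df => e'; apply: hw; rewrite /= add1n e'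
     | move=> [|[] w] //= [sw]; rewrite ?kdiff0 ?scaler0 ?sub0r;
       [ by rewrite -scaleN1r; apply: is_submodZ => //; apply: Df
       | by case: hB]
     | idtac]).
    exists (fun=> 0); split=> // [_|w sw]; first by case: hA.
    have /(gB 0%N) := hG (true :: w) (congr1 succn sw).
    by rewrite /= !pihomogB pihomog0_Xmul pihomog0_kdiff fe kdiff0 !subr0.
  pose u' w : S^o := pihomog mdeg e (G (false :: w) : S).
  pose v' w : S^o := pihomog mdeg e (G (true :: w) : S).
  have [||||g [Ag dg hg]] := IH u'.
  - by move=> w; apply: gA.
  - by move=> w hw; rewrite /u' dG ?pihomog0.
  - by move=> w; rewrite /u' pihomog_id.
  - move=> w sw; have /(gB e.+1) := hG (false :: w) (congr1 succn sw).
    rewrite /= pihomogB pihomog0 pihomog_kdiff sub0r => h1.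
    by rewrite -[kdiff _ _ _]opprK -scaleN1r; apply: is_submodZ.
  exists (fun w => 'X_v *: g w - v' w); split=> [w|w hw|w sw].
  - by apply: is_submodB => //; [apply: is_submodZ | apply: gA].
  - by rewrite dg // scaler0 sub0r /v' dG ?pihomog0 ?oppr0 // => -[].
  have /(gB e.+1) := hG (true :: w) (congr1 succn sw).
  rewrite /= !pihomogB fe pihomog_Xmul pihomog_kdiff => h1.
  rewrite kdiffB kdiffZ.
  have h2 := is_submodZ 'X_v hB (hg w sw).
  have := is_submodD hB h1 h2.
  rewrite [X in B X](_ : _ = f w - ('X_v *: kdiff (vars s) g w - kdiff (vars s) v' w)) //.
  by rewrite scalerBr !opprB -addrA subrKA.
move=> f Af df Df.
pose E := \max_(t : (size (vars s)).-tuple bool) msize (f t : S).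
have /choice[g hg] : forall e, exists g : seq bool -> S^o,
    [/\ forall w, A (g w), kdegp i g &
    forall w, size w = size (vars s) ->
      B (pihomog mdeg e (f w : S) - kdiff (vars s) g w)].
  move=> e; apply: (piece e) => [w|w hw|w|w sw].
  - exact: gA.
  - by rewrite df ?pihomog0.
  - by rewrite pihomog_id.
  - by rewrite -pihomog_kdiff; apply: gB; apply: Df.
exists (fun w => \sum_(e < E) g e w); split=> [w|w hw|w sw].
- by apply: is_submod_sum => // e _; case: (hg e).
- by rewrite big1 // => e _; case: (hg e) => _ -> .
rewrite kdiff_sum {1}(@pihomog_partitionE _ _ mdeg E (f w)); last first.
  have tw : size w == size (vars s) by rewrite sw.
  exact: (@leq_bigmax _ (fun t : (size (vars s)).-tuple bool =>
    msize (f t : S)) (Tuple tw)).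
rewrite -sumrB; apply: is_submod_sum => // e _; by case: (hg e) => _ _; apply.
Qed.

Lemma kvanish_drops s1 s2 A B i :
  is_submod A -> is_submod B -> is_homog A -> is_homog B ->
  kvanish (vars (s1 ++ s2)) A B (size s1 + i) -> kvanish (vars s2) A B i.
Proof.
move=> hA hB gA gB; elim: s1 => // v s1 IH h.
by apply: IH; apply: (kvanish_drop (v := v)).
Qed.

End Drop.

(** * Regular sequences on subquotients *)

Section IdealMul.
Variables (S : comNzRingType) (M : lmodType S).
Implicit Types (a : seq S) (x y : M).

Lemma in_ideal_mulP a x :
  in_ideal_mul a x <-> exists y : nat -> M, x = \sum_(i < size a) a`_i *: y i.
Proof.
split=> [[y ->]|[y ->]]; last by exists (fun i => y i).
exists (fun i => if insub i is Some j then y j else 0).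
by apply: eq_bigr => i _; rewrite valK.
Qed.

Lemma in_ideal_mul_nil x : in_ideal_mul [::] x <-> x = 0.
Proof.
rewrite in_ideal_mulP; split=> [[y ->]|->]; first by rewrite big_ord0.
by exists (fun=> 0); rewrite big_ord0.
Qed.

Lemma in_ideal_mul_rcons a b x :
  in_ideal_mul (rcons a b) x <-> exists y, in_ideal_mul a (x - b *: y).
Proof.
split=> [/in_ideal_mulP[y ->]|[y /in_ideal_mulP[z hz]]].
  exists (y (size a)); apply/in_ideal_mulP; exists y.
  rewrite size_rcons big_ord_recr /= nth_rcons ltnn eqxx addrK.
  by apply: eq_bigr => i _; rewrite nth_rcons ltn_ord.
apply/in_ideal_mulP; exists (fun i => if i == size a then y else z i).
rewrite size_rcons big_ord_recr /= nth_rcons ltnn !eqxx.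
rewrite -[LHS](subrK (b *: y)) hz; congr (_ + _).
by apply: eq_bigr => i _; rewrite nth_rcons ltn_ord; case: eqP (ltn_ord i) => // ->;
  rewrite ltnn.
Qed.

Lemma in_ideal_mul_submod a : is_submod (@in_ideal_mul S M a).
Proof.
split=> [|c x y /in_ideal_mulP[u ->] /in_ideal_mulP[v ->]]; apply/in_ideal_mulP.
  by exists (fun=> 0); rewrite big1 // => i _; rewrite scaler0.
exists (fun i => c *: u i + v i); rewrite scaler_sumr -big_split /=.
by apply: eq_bigr => i _; rewrite scalerDr !scalerA mulrC.
Qed.

End IdealMul.

(** pi presents Q as A / B. It is total for convenience, and constrained on A only.
    *)
Record presents (S : comNzRingType) (M Q : lmodType S) (A B : M -> Prop)
    (pi : M -> Q) : Prop := Presents {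
  pres_A : is_submod A;
  pres_lin : forall a x y, A x -> A y -> pi (a *: x + y) = a *: pi x + pi y;
  pres_ker : forall x, B x <-> A x /\ pi x = 0;
  pres_surj : forall q, exists2 x, A x & pi x = q }.

Section Presents.
Variables (S : comNzRingType) (M Q : lmodType S) (A B : M -> Prop) (pi : M -> Q).
Hypothesis hpi : presents A B pi.

Let hA := pres_A hpi.

Lemma pres0 : pi 0 = 0.
Proof.
have A0 : A 0 by case: hA.
by have := pres_lin hpi (-1) A0 A0; rewrite scaler0 addr0 scaleN1r addNr.
Qed.

Lemma presZ a x : A x -> pi (a *: x) = a *: pi x.
Proof.
move=> Ax; have A0 : A 0 by case: hA.
by rewrite -[a *: x]addr0 (pres_lin hpi) // pres0 addr0.
Qed.

Lemma presB x y : A x -> A y -> pi (x - y) = pi x - pi y.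
Proof.
move=> Ax Ay; rewrite addrC -scaleN1r (pres_lin hpi) // scaleN1r addrC //.
Qed.

Lemma pres_B : is_submod B.
Proof.
split=> [|a x y /(pres_ker hpi)[Ax px] /(pres_ker hpi)[Ay py]]; apply/(pres_ker hpi).
  by rewrite pres0; split=> //; case: hA.
rewrite (pres_lin hpi) // px py scaler0 addr0; split=> //.
by case: hA => _; apply.
Qed.

(** Each member of a regular sequence in the ideal of zs kills one more degree of
    Koszul cohomology. The induction runs down from the quotient by the whole
    sequence, about which nothing is claimed, to Q itself. *)
Lemma kvanish_regular_sequence (zs : seq S) (s : seq S) :
  regular_sequence Q s ->
  (forall a, a \in s -> exists c : nat -> S, a = \sum_(k < size zs) c k * zs`_k) ->
  forall i, (i < size s)%N -> kvanish zs A B i.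
Proof.
move=> [reg _] szs.
pose Bj j x := A x /\ in_ideal_mul (take j s) (pi x).
have hBj j : is_submod (Bj j).
  split=> [|a x y [Ax hx] [Ay hy]]; split.
  - by case: hA.
  - by rewrite pres0; case: (@in_ideal_mul_submod S Q (take j s)).
  - by case: hA => _; apply.
  - by rewrite (pres_lin hpi) //; case: (@in_ideal_mul_submod S Q (take j s)) => _; apply.
have B0 : Bj 0%N = B.
  apply/funext => x; apply/propext; rewrite /Bj take0.
  by rewrite (pres_ker hpi) in_ideal_mul_nil.
suff H d j : (j + d)%N = size s -> forall i, (i < d)%N -> kvanish zs A (Bj j) i.
  by move=> i hi; rewrite -B0; apply: (H (size s)).
elim: d j => // d IH j jd i hi.
have js : (j < size s)%N by rewrite -jd addnS ltnS leq_addr.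
have [c hc] := szs _ (mem_nth 0 js).
apply: (kvanish_regular hA (hBj j) _ hc (B' := Bj j.+1)).
- by move=> x [].
- move=> x; rewrite /Bj (take_nth 0 js) in_ideal_mul_rcons.
  split=> [[Ax [y hy]]|[Ax [u Au [_ hu]]]].
    have [u Au uy] := pres_surj hpi y; split=> //; exists u => //; split.
      by apply: is_submodB => //; apply: is_submodZ.
    by rewrite presB ?presZ ?uy //; apply: is_submodZ.
  split=> //; exists (pi u); move: hu; rewrite presB ?presZ //.
  exact: is_submodZ.
- move=> x Ax [_]; rewrite presZ // => /(reg j js) hx; by split.
- move=> k ki; apply: IH; first by rewrite addSnnS.
  by rewrite -ltnS ki.
Qed.

Lemma pres_annihilates a : annihilates Q a <-> forall x, A x -> B (a *: x).
Proof.
split=> [h x Ax|h q]; last first.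
  have [x Ax <-] := pres_surj hpi q; rewrite -presZ //.
  by have /(pres_ker hpi)[] := h x Ax.
by apply/(pres_ker hpi); rewrite presZ ?h //; split=> //; apply: is_submodZ.
Qed.

End Presents.

Section Subquot.
Variables (n : nat) (F : fieldType).
Local Notation S := {mpoly F[n]}.
Variables (I : submodClosed (S^o : lmodType S)).

(** Submodules of S / I are handled through their preimages, which are ideals of S.
    *)
Definition preim_submod (N : submodClosed (quotmod I)) (f : S^o) : Prop :=
  quotmod_proj I f \in N.

Lemma preim_is_submod N : is_submod (preim_submod N).
Proof.
split=> [|a x y]; rewrite /preim_submod; first by rewrite raddf0 rpred0.
by rewrite linearP => hx hy; rewrite rpredD ?rpredZ.
Qed.

Section Pres.
Variables (N L : submodClosed (quotmod I)).
Hypothesis sLN : {subset L <= N}.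

Definition subquot_proj (f : S^o) : subquot N L :=
  if insub (quotmod_proj I f) is Some x then quotmod_proj (restr_submod L (N := N)) x
  else 0.

Lemma subquot_projE (f : S^o) (x : submod N) : val x = quotmod_proj I f ->
  subquot_proj f = quotmod_proj (restr_submod L (N := N)) x.
Proof. by rewrite /subquot_proj => <-; rewrite valK. Qed.

Lemma preim_lift f : preim_submod N f -> exists x : submod N, val x = quotmod_proj I f.
Proof. by move=> Nf; exists (Submod (Nf : quotmod_proj I f \in zsubmod N)). Qed.

Lemma presents_subquot :
  presents (preim_submod N) (preim_submod L) subquot_proj.
Proof.
split; first exact: preim_is_submod.
- move=> a x y /preim_lift[u hu] /preim_lift[v hv].
  rewrite (subquot_projE hu) (subquot_projE hv) -linearP.
  by apply: subquot_projE; rewrite !linearP /= hu hv.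
- move=> x; split=> [Lx|[/preim_lift[u hu]]].
    have Nx : preim_submod N x by apply: sLN.
    split=> //; have [u hu] := preim_lift Nx.
    rewrite (subquot_projE hu); apply/quotmod_proj0.
    by rewrite -[_ \in _]/(val u \in L) hu.
  rewrite (subquot_projE hu) => /quotmod_proj0.
  by rewrite -[_ \in _]/(val u \in L) hu.
- move=> q; pose x := val (quotmod_repr (q : quotmod (restr_submod L (N := N)))).
  have xE : quotmod_proj I (quotmod_repr x) = x by exact: quotmod_reprK.
  exists (quotmod_repr x).
    by rewrite /preim_submod xE; exact: (valP (quotmod_repr (q : quotmod (restr_submod L
      (N := N))))).
  by rewrite (subquot_projE (esym xE)) quotmod_reprK.
Qed.

End Pres.
End Subquot.

(** * Exactness of the Koszul complex in degree one *)

Section DegreeOne.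
Variables (S : comNzRingType) (M : lmodType S) (T : eqType) (z : T -> S).
Implicit Types (phi : T -> M) (s : seq T) (w : seq bool).

Definition cochain0 (x : M) w : M := if count id w == 0%N then x else 0.

(** The cochain of degree 1 with value phi y on the generator of y in s. *)
Fixpoint cochain1 phi s w : M :=
  match s, w with
  | x :: _, true :: w' => cochain0 (phi x) w'
  | _ :: s', false :: w' => cochain1 phi s' w'
  | _, _ => 0
  end.

Lemma cochain1_in (B : M -> Prop) phi s w : is_submod B ->
  (forall x, x \in s -> B (phi x)) -> B (cochain1 phi s w).
Proof.
move=> hB; have B0 : B 0 by case: hB.
elim: s w => [|x s IH] [|[] w] //= hs.
  by rewrite /cochain0; case: ifP => // _; apply: hs; rewrite mem_head.
by apply: IH => y ys; apply: hs; rewrite inE ys orbT.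
Qed.

Lemma cochain1_linear a phi psi s w :
  a *: cochain1 phi s w - cochain1 psi s w = cochain1 (fun x => a *: phi x - psi x) s w.
Proof.
elim: s w => [|x s IH] [|[] w] //=; rewrite ?scaler0 ?subr0 //.
by rewrite /cochain0; case: ifP => _; rewrite ?scaler0 ?subr0.
Qed.

Lemma kdiff_cochain0 x s w : size w = size s ->
  kdiff (map z s) (cochain0 x) w = cochain1 (fun y => z y *: x) s w.
Proof.
elim: s w => [|y s IH] [|[] w] //= [sw].
  rewrite (_ : (fun v => _) = fun=> 0) ?kdiff0 ?subr0; last first.
    by apply/funext => v.
  by rewrite /cochain0 /=; rewrite add0n; case: ifP => _; rewrite ?scaler0.
by rewrite (_ : (fun v => _) = cochain0 x) ?IH.
Qed.

Lemma kdiff_cochain1_in (B : M -> Prop) phi s w : is_submod B -> size w = size s ->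
  (forall x y, x \in s -> y \in s -> B (z x *: phi y - z y *: phi x)) ->
  B (kdiff (map z s) (cochain1 phi s) w).
Proof.
move=> hB; have B0 : B 0 by case: hB.
elim: s w => [|x s IH] [|[] w] //= [sw] hs; last first.
  by apply: IH => // u v us vs; apply: hs; rewrite inE ?us ?vs orbT.
rewrite (_ : (fun v => _) = cochain0 (phi x)) // kdiff_cochain0 //.
rewrite cochain1_linear; apply: cochain1_in => // y ys.
by apply: hs; rewrite inE ?eqxx ?ys ?orbT.
Qed.

Lemma cochain1_deg phi s : kdeg 1 (cochain1 phi s).
Proof.
elim: s => [|x s IH] [|[] w] //= hw.
  by rewrite /cochain0; case: eqP => // e; case: hw; rewrite e.
by apply: IH.
Qed.

Lemma cochain1_word s x : uniq s -> x \in s ->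
  exists2 w, size w = size s & forall phi, cochain1 phi s w = phi x.
Proof.
elim: s => //= y s IH /andP[ys us]; rewrite inE => /orP[/eqP ->|xs].
  exists (true :: nseq (size s) false) => [|phi]; first by rewrite /= size_nseq.
  by rewrite /= /cochain0 count_nseq.
have [w sw hw] := IH us xs.
by exists (false :: w) => [|phi]; rewrite /= ?sw.
Qed.

Lemma count0_nseq w : count id w = 0%N -> w = nseq (size w) false.
Proof. by elim: w => [|[] w IH] //= /IH <-. Qed.

(** Exactness in degree 1 spelled out: a family phi that satisfies the relations of
    the multiples z x *: h of one element is such a family, up to B. *)
Lemma kvanish1P (A B : M -> Prop) phi s : is_submod A -> is_submod B -> uniq s ->
  kvanish (map z s) A B 1 -> (forall x, x \in s -> A (phi x)) ->
  (forall x y, x \in s -> y \in s -> B (z x *: phi y - z y *: phi x)) ->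
  exists h, A h /\ forall x, x \in s -> B (phi x - z x *: h).
Proof.
move=> hA hB us vAB Aphi hphi.
have [w||g [Ag dg hg]] := vAB (cochain1 phi s) _ (@cochain1_deg phi s).
- exact: cochain1_in.
- by move=> w sw; apply: kdiff_cochain1_in => //; rewrite sw size_map.
exists (g (nseq (size s) false)); split=> // x xs.
have [w sw hw] := cochain1_word us xs.
have := hg w; rewrite size_map => /(_ sw).
rewrite (@eq_kdiff _ _ _ _ (cochain0 (g (nseq (size s) false)))) ?size_map //.
  by rewrite kdiff_cochain0 // -[cochain1 phi s w]scale1r cochain1_linear hw scale1r.
move=> v sv; rewrite /cochain0; case: eqP => [/count0_nseq ->|cv].
  by rewrite sv.
by rewrite dg // => -[].
Qed.

End DegreeOne.

(** * Chains of monomial primes *)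

Section Chains.
Variables (n : nat) (F : fieldType).
Local Notation S := {mpoly F[n]}.
Implicit Types (W : {set 'I_n}).

Lemma vars_gen (s : seq 'I_n) (a : S) : perm_eq s (enum 'I_n) -> a@_0%MM = 0 ->
  exists c : nat -> S, a = \sum_(k < size (vars F s)) c k * (vars F s)`_k.
Proof.
move=> ps /mcoeff0_sumX[g ->].
case: s ps => [|v0 s] ps.
  exists (fun=> 0); rewrite big_ord0 big1 // => v _.
  by have := mem_enum 'I_n v; rewrite -(perm_mem ps).
exists (fun k => g (nth v0 (v0 :: s) k)).
rewrite -big_enum -(perm_big _ ps) (big_nth v0) big_mkord size_map.
by apply: eq_bigr => k _; rewrite (nth_map v0).
Qed.

Lemma mem_killed_by W f : (f \in killed_by (F:=F) W) = (kill W f == 0).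
Proof. by []. Qed.

(** Adding the variables outside W one at a time gives a chain of monomial primes.
    *)
Lemma killed_chain (Q : lmodType S) W :
  (forall a, annihilates Q a -> kill W a = 0) ->
  exists P, prime_chain Q #|~: W| P.
Proof.
move=> hQ; pose Wi i := W :|: [set v in take i (enum (~: W))].
exists (fun i => killed_by (F:=F) (Wi i)); split=> i hi.
  split=> [|a /hQ ka]; first exact: killed_prime.
  by rewrite mem_killed_by /Wi setUC -kill_kill ka raddf0.
have sz : (i < size (enum (~: W)))%N by rewrite -cardE.
have v0 : 'I_n by case: (enum (~: W)) sz.
have WiS : Wi i.+1 = [set nth v0 (enum (~: W)) i] :|: Wi i.
  apply/setP => v; rewrite /Wi (take_nth v0) // !inE mem_rcons inE.
  by rewrite orbCA orbA.
split=> [f|].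
  by rewrite !mem_killed_by => /eqP fi; rewrite WiS -kill_kill fi raddf0.
exists ('X_(nth v0 (enum (~: W)) i)).
  by rewrite mem_killed_by killU WiS !inE eqxx.
rewrite mem_killed_by killU; set v := nth _ _ _.
have vW : v \in enum (~: W) by apply: mem_nth.
rewrite ifF; last first.
  rewrite !inE; move: vW; rewrite mem_enum inE => /negPf -> /=.
  have := enum_uniq (~: W); rewrite -{1}(cat_take_drop i (enum (~: W))) cat_uniq.
  case/and3P=> _ /hasPn h _; apply/negbTE; apply: h.
  by rewrite (drop_nth v0) // mem_head.
by rewrite -msupp_eq0 msuppX.
Qed.

Lemma krull_dim_ge (Q : lmodType S) W d :
  (forall a, annihilates Q a -> kill W a = 0) -> krull_dim Q d -> (#|~: W| <= d)%N.
Proof. by move=> /killed_chain[P hP] [_]; apply; exact: hP. Qed.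

End Chains.

(** * The filtration of a sequentially Cohen-Macaulay quotient *)

Section Homog.
Variables (n : nat) (F : fieldType) (I : submodClosed ({mpoly F[n]}^o)).
Hypothesis homI : homogeneous_ideal I.

(** The homogeneous components of a class are the classes of the components, because
    I is homogeneous. *)
Lemma preim_homog (N : submodClosed (quotmod I)) :
  graded_submod (quot_grading homI) N -> is_homog (preim_submod N).
Proof.
move=> gN e x Nx; have [D [u [hu xE]]] := gN _ Nx.
have /choice[f hf] : forall d, exists f : {mpoly F[n]},
    (forall m, m \in msupp f -> (mdeg m)%:Z = d) /\ u d = quotmod_proj I f.
  by move=> d; case: (hu d) => /asboolP.
have : x - \sum_(d <- D) f d \in I.
  apply/quotmod_proj0; rewrite raddfB raddf_sum /= xE; apply/eqP.
  by rewrite subr_eq0; apply/eqP/eq_bigr => d _; case: (hf d).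
move/(homI e); rewrite pihomogB => /quotmod_projE.
rewrite /preim_submod => ->.
have -> : pihomog mdeg e (\sum_(d <- D) f d) =
  \sum_(d <- D) pihomog mdeg e (f d) by exact: raddf_sum.
rewrite (raddf_sum (quotmod_proj I)).
apply: rpred_sum => d _; have [hd ud] := hf d.
have [de|de] := eqVneq d e%:Z.
  have -> : pihomog mdeg e (f d) = f d.
    by apply: pihomog_dE; apply/dhomogP => m /hd; rewrite de => -[].
  by case: (hu d) => _; rewrite ud.
rewrite (_ : pihomog _ _ _ = 0) ?raddf0 ?rpred0 //.
apply/mpolyP => m; rewrite mcoeff_pihomog mcoeff0; case: eqP => // me.
apply/eqP; rewrite mcoeff_eq0; apply/negP => /hd mE.
by case/eqP: de; rewrite -mE me.
Qed.

End Homog.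

(** * Graphs without vertices of degree one *)

Section Filtration.
Variables (n : nat) (F : fieldType) (I : submodClosed ({mpoly F[n]}^o)).
Hypothesis homI : homogeneous_ideal I.
Local Notation S := {mpoly F[n]}.

Lemma krull_dim_uniq (Q : lmodType S) d d' :
  krull_dim Q d -> krull_dim Q d' -> d = d'.
Proof.
move=> [[P hP] hd] [[P' hP'] hd']; apply/eqP.
by rewrite eqn_leq (hd' _ _ hP) (hd _ _ hP').
Qed.

(** L is the preimage of the last step of the filtration with only quotients of
    dimension less than m below it. The quotients above it have depth at least m,
    whence the vanishing. A prime (W) of dimension at least m that contains one step
    contains the next, since otherwise it would contain the annihilator of their
    quotient, whose dimension would then be at least m. *)
Lemma sequentially_CM_truncation (m : nat) :
  sequentially_CM (quot_grading homI) ->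
  exists L : S^o -> Prop,
    [/\ is_submod L, is_homog L, (forall f, f \in I -> L f),
      forall W, (m <= #|~: W|)%N -> (forall f, f \in I -> kill W f = 0) ->
         forall f, L f -> kill W f = 0 &
      forall s i, perm_eq s (enum 'I_n) -> (i < m)%N ->
        kvanish (vars F s) (fun=> True) L i].
Proof.
move=> [r [N [N0 Nr gN sN dN]]].
have sub i : (i < r)%N -> {subset N i <= N i.+1} by move=> /sN[].
have /choice[dl hdl] : forall i, exists d, (i < r)%N ->
    krull_dim (subquot (N i.+1) (N i)) d /\ depth (subquot (N i.+1) (N i)) d.
  move=> i; case: (boolP (i < r)%N) => [/sN[_ [d h1 h2]]|_]; last by exists 0%N.
  by exists d.
have dl_mono i j : (i <= j)%N -> (j < r)%N -> (dl i <= dl j)%N.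
  elim: j => [|j IH]; first by rewrite leqn0 => /eqP ->.
  rewrite leq_eqVlt => /orP[/eqP -> //|ij] jr.
  have jr' := ltnW jr.
  apply: leq_trans (IH ij jr') _.
  have [d [d' [h1 h2 h3]]] := dN j jr.
  rewrite -(krull_dim_uniq h1 (proj1 (hdl j jr'))).
  by rewrite -(krull_dim_uniq h2 (proj1 (hdl j.+1 jr))) ltnW.
have ext : exists t, (t == r) || (m <= dl t)%N by exists r; rewrite eqxx.
(* t is the number of quotients of dimension less than m. *)
case: (ex_minnP ext) => t Pt tmin.
have tr : (t <= r)%N by apply: tmin; rewrite eqxx.
have lowt i : (i < t)%N -> (dl i < m)%N.
  move=> it; rewrite ltnNge; apply/negP => mi.
  by have := tmin i; rewrite mi orbT leqNgt it => /(_ isT).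
have hight i : (t <= i)%N -> (i < r)%N -> (m <= dl i)%N.
  move=> ti ir; case/orP: Pt => [/eqP e|mt];
    first by move: (leq_ltn_trans ti ir); rewrite e ltnn.
  exact: leq_trans mt (dl_mono _ _ ti ir).
have homN i : (i <= r)%N -> is_homog (preim_submod (N i)).
  by move=> ir; apply: preim_homog; apply: gN.
have subN i j : (i <= j)%N -> (j <= r)%N -> {subset N i <= N j}.
  elim: j => [|j IH]; first by rewrite leqn0 => /eqP -> _ x.
  rewrite leq_eqVlt => /orP[/eqP -> _ x //|ij] jr x Nx.
  by apply: sub => //; apply: IH => //; apply: ltnW.
have IN i : (i <= r)%N -> forall f, f \in I -> preim_submod (N i) f.
  move=> ir f If; apply: (subN 0%N) => //; rewrite N0 inE; apply/eqP.
  exact/quotmod_proj0.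
exists (preim_submod (N t)); split.
- exact: preim_is_submod.
- exact: homN.
- exact: IN.
- move=> W mW IW.
  suff H i : (i <= t)%N -> forall f, preim_submod (N i) f -> kill W f = 0 by apply: H.
  elim: i => [_ f|i IH it f Nf].
    by rewrite /preim_submod N0 inE => /eqP/quotmod_proj0/IW.
  apply: contrapT => kf.
  have ir : (i < r)%N by apply: leq_trans tr.
  have [kd _] := hdl i ir.
  suff : (#|~: W| <= dl i)%N.
    by rewrite leqNgt (leq_trans (lowt i it) mW).
  apply: krull_dim_ge kd => a.
  rewrite (pres_annihilates (presents_subquot (sub i ir))) => /(_ f Nf) /(IH (ltnW it)).
  rewrite [a *: _]/(a * _) rmorphM /= => /eqP; rewrite mulf_eq0 => /orP[/eqP //|/eqP e].
  by case: kf.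
- move=> s i ps im.
  have -> : (fun=> True) = preim_submod (N r).
    by apply/funext => f; apply/propext; rewrite /preim_submod Nr.
  suff H d : (t + d <= r)%N ->
      kvanish (vars F s) (preim_submod (N (t + d)%N)) (preim_submod (N t)) i.
    by rewrite -(subnKC tr); apply: H; rewrite subnKC.
  elim: d => [|d IH] tdr;
    first by rewrite addn0; apply: kvanish_refl; apply: preim_is_submod.
  rewrite addnS in tdr *.
  apply: (kvanish_trans (B := preim_submod (N (t + d)%N))).
  + exact: preim_is_submod.
  + exact: preim_is_submod.
  + by move=> f; apply: sub.
  + by move=> f; apply: subN; [exact: leq_addr | exact: ltnW].
  + have [_ [[a [a0 rega] sa] _]] := hdl _ tdr.
    apply: (kvanish_regular_sequence (presents_subquot (sub _ tdr)) rega).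
      by move=> b /(allP a0) /eqP b0; apply: vars_gen.
    by rewrite sa; apply: leq_trans im _; apply: hight => //; apply: leq_addr.
  + by apply: IH; apply: ltnW.
Qed.

End Filtration.

Section Graph.
Variables (n : nat) (F : fieldType) (e : rel 'I_n) (A : {set 'I_n}).
Local Notation S := {mpoly F[n]}.
Local Notation I := (edge_ideal (F:=F) e).

Hypothesis bip : forall u v, e u v -> (u \in A) != (v \in A).
Hypothesis deg2 : forall b, b \notin A ->
  exists a a', [/\ a != a', a \in A, a' \in A, e a b & e a' b].
Hypothesis leA : (#|A| <= #|~: A|)%N.
Hypothesis B_gt0 : (0 < #|~: A|)%N.

Lemma edge_ideal_mem u v (f : S) : e u v -> ('X_u * 'X_v * f : S^o) \in I.
Proof.
move=> euv; rewrite mulrC; apply: (@rpredZ _ S^o); apply/asboolP.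
exists 1%N, (fun=> 1), (fun=> 'X_u * 'X_v); split=> [_|]; first by exists u, v.
by rewrite big_ord1 mul1r.
Qed.

Lemma edge_ideal_kill (W : {set 'I_n}) : (forall u v, e u v -> (u \in W) || (v \in W)) ->
  forall f : S^o, f \in I -> kill W f = 0.
Proof.
move=> hW f /asboolP[m [c [g [hg ->]]]]; rewrite raddf_sum big1 //= => i _.
have [u [v [/hW euv ->]]] := hg i.
rewrite !rmorphM /= !killU; case/orP: euv => -> ; by rewrite ?mul0r ?mulr0 ?mul0r ?mulr0.
Qed.

(** The family nn attaches to each subset W of A of size m - 1 - j an element that
    plays the role of X_W h, for a function h equal to 1 on the component V(B) of
    V(L) and to 0 on the others. At stage 0 this element is X_W, although h itself
    is not yet known; at the last stage, W is empty and it is h. *)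
Lemma leafless_not_SCM : ~ sequentially_CM (edge_grading F e).
Proof.
move=> /(sequentially_CM_truncation #|A|) [L [hL gL IL kL vL]].
have kA f : L f -> kill A f = 0.
  apply: kL => //; apply: edge_ideal_kill => u v /bip.
  by case: (u \in A) => //; case: (v \in A).
have kB f : L f -> kill (~: A) f = 0.
  apply: kL; first by rewrite setCK.
  apply: edge_ideal_kill => u v /bip; rewrite !inE.
  by case: (u \in A) => //; case: (v \in A).
have L0 : L 0 by case: hL.
pose X (W : {set 'I_n}) : S := \prod_(v in W) 'X_v.
have kX (W : {set 'I_n}) : W \subset A -> kill (~: A) (X W) = X W.
  move=> /subsetP WA; rewrite rmorph_prod /=; apply: eq_bigr => v /WA vA.
  by rewrite killU inE vA.
have XU v (W : {set 'I_n}) : v \notin W -> X (v |: W) = 'X_v * X W.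
  by move=> vW; rewrite /X big_setU1.
have [b0 b0A] : exists b0, b0 \notin A.
  by have /card_gt0P[b] := B_gt0; rewrite inE; exists b.
have A_gt0 : (0 < #|A|)%N.
  by have [a [_ [_ aA _ _ _]]] := deg2 b0A; apply/card_gt0P; exists a.
(* Dropping the variables of W leaves exactness in degree #|W| + 1 - #|W| = 1. *)
have exact1 (W : {set 'I_n}) (phi : 'I_n -> S) : (#|W|.+1 < #|A|)%N ->
  (forall v w, v \notin W -> w \notin W -> L ('X_v * phi w - 'X_w * phi v)) ->
  exists h : S, forall v, v \notin W -> L (phi v - 'X_v * h).
  move=> cW hphi.
  have vW : kvanish (vars F (enum (~: W))) (fun=> True) L 1.
    apply: (@kvanish_drops _ _ (enum W)) => //.
    apply: vL; last by rewrite -cardE addn1.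
    apply: uniq_perm => [||v]; rewrite ?enum_uniq //.
      rewrite cat_uniq !enum_uniq andbT; apply/hasPn => v.
      by rewrite !mem_enum inE.
    by rewrite mem_cat !mem_enum !inE orbN.
  have [//|//|v w|h [_ hh]] := @kvanish1P _ S^o _ (fun v =>
    'X_v : S) _ L phi _ _ hL (enum_uniq (~: W)) vW.
    by rewrite !mem_enum !inE; apply: hphi.
  by exists h => v vW'; apply: hh; rewrite mem_enum inE.
have step j : (j < #|A|)%N -> exists nn : {set 'I_n} -> S,
  [/\ forall (W : {set 'I_n}) b, W \subset A -> #|W| = (#|A|.-1 - j)%N ->
        b \notin A -> L ('X_b * nn W),
      forall (W : {set 'I_n}) v w, W \subset A -> #|W|.+1 = (#|A|.-1 - j)%N ->
        v \in A -> w \in A -> v \notin W -> w \notin W ->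
        L ('X_v * nn (w |: W) - 'X_w * nn (v |: W)) &
      forall (W : {set 'I_n}), W \subset A -> #|W| = (#|A|.-1 - j)%N ->
        kill (~: A) (nn W) = X W].
  elim: j => [_|j IH jA].
    exists X; split; last by move=> W WA _; apply: kX.
      move=> W b WA; rewrite subn0 => cW bA.
      have [a [a' [aa' aA a'A eab ea'b]]] := deg2 bA.
      (* W lacks a single element of A, so it contains one of the two neighbours. *)
      wlog aW : a a' aa' aA a'A eab ea'b / a \in W => [hwlog|].
        case: (boolP (a \in W)) => [aW|aW]; first exact: (hwlog a a').
        apply: (hwlog a' a) => //; first by rewrite eq_sym.
        apply: contraT => a'W.
        suff : (#|[set a; a']| + #|W| <= #|A|)%N.
          rewrite cards2 aa' cW; case: #|A| A_gt0 => //= k _.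
          by rewrite add2n ltnn.
        rewrite addnC -leq_subRL; last exact: subset_leq_card.
        rewrite -(cardsDS (A := A)) //; apply: subset_leq_card.
        by apply/subsetP => x; rewrite !inE => /orP[]/eqP ->; apply/andP.
      apply: IL; rewrite /X (bigD1 a) //= mulrA ['X_b * _]mulrC.
      exact: edge_ideal_mem.
    move=> W v w WA _ vA wA vW wW.
    have [->|vw] := eqVneq v w; first by rewrite subrr.
    rewrite -!XU ?inE ?negb_or ?vW ?wW ?andbT //; last by rewrite eq_sym.
    by rewrite setUCA subrr.
  have [nn [hb hc hk]] := IH (ltnW jA).
  have jE : (#|A|.-1 - j)%N = (#|A|.-1 - j.+1).+1.
    by rewrite subnS prednK // subn_gt0 -ltnS prednK.
  have /choice[nn' hnn'] : forall W : {set 'I_n}, exists h : S, W \subset A ->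
      #|W| = (#|A|.-1 - j.+1)%N -> forall v, v \notin W ->
      L ((if v \in A then nn (v |: W) else 0) - 'X_v * h).
    move=> W; have [WA|] := boolP (W \subset A); last by exists 0.
    have [cW|/eqP cW] := eqVneq #|W| (#|A|.-1 - j.+1)%N; last by exists 0.
    have [||h hh] := @exact1 W (fun v => if v \in A then nn (v |: W) else 0).
    - rewrite cW -jE; case: #|A| A_gt0 => //= k _; by rewrite ltnS leq_subr.
    - move=> v w vW wW.
      have cU x : x \notin W -> #|x |: W| = (#|A|.-1 - j)%N.
        by move=> xW; rewrite cardsU1 xW add1n cW jE.
      case: (boolP (v \in A)) => vA; case: (boolP (w \in A)) => wA;
        rewrite ?mulr0 ?subr0 ?sub0r //.
      + by apply: hc => //; rewrite cW jE.
      + rewrite -mulrN -[- nn _]scaleN1r -scalerAr scaleN1r -['X_w * _]opprK opprK.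
        rewrite -scaleN1r -mul_mpolyC; apply: (is_submodZ (-1)%:MP hL).
        by apply: hb; rewrite ?cU // subUset sub1set vA.
      + by apply: hb; rewrite ?cU // subUset sub1set wA.
    by exists h.
  have nnE (W : {set 'I_n}) v : W \subset A -> #|W| = (#|A|.-1 - j.+1)%N ->
      v \notin W -> v \in A -> L (nn (v |: W) - 'X_v * nn' W).
    by move=> WA cW vW vA; have := hnn' W WA cW v vW; rewrite vA.
  exists nn'; split.
  - move=> W b WA cW bA; have bW : b \notin W by apply: contra bA; apply/subsetP.
    have := hnn' W WA cW b bW; rewrite (negPf bA) sub0r => h.
    by rewrite -['X_b * _]opprK -scaleN1r -mul_mpolyC; apply: (is_submodZ (-1)%:MP hL).
  - move=> W v w WA cW vA wA vW wW.
    have [->|vw] := eqVneq v w; first by rewrite subrr.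
    have h1 : L (nn (v |: (w |: W)) - 'X_v * nn' (w |: W)).
      apply: nnE => //; rewrite ?subUset ?sub1set ?wA ?cardsU1 ?wW ?add1n //.
      by rewrite !inE negb_or vw.
    have h2 : L (nn (w |: (v |: W)) - 'X_w * nn' (v |: W)).
      apply: nnE => //; rewrite ?subUset ?sub1set ?vA ?cardsU1 ?vW ?add1n //.
      by rewrite !inE negb_or eq_sym vw.
    have := is_submodB hL h2 h1; rewrite [w |: (v |: W)]setUCA.
    by rewrite opprB addrC subrKA.
  - move=> W WA cW.
    have [x xA xW] : exists2 x, x \in A & x \notin W.
      have /card_gt0P[x] : (0 < #|A :\: W|)%N.
        rewrite cardsDS // cW subn_gt0 -(prednK A_gt0) ltnS; exact: leq_subr.
      by rewrite inE => /andP[]; exists x.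
    have /kB := nnE W x WA cW xW xA.
    rewrite raddfB /= rmorphM /= killU inE xA /= hk; first last.
    - by rewrite cardsU1 xW add1n cW jE.
    - by rewrite subUset sub1set xA.
    rewrite XU // -mulrBr => /eqP; rewrite mulf_eq0 -msupp_eq0 msuppX /= subr_eq0.
    by move/eqP.
have [|nn [hb _ hk]] := step #|A|.-1; first by rewrite prednK.
rewrite subnn in hb hk.
have h1 := hk set0 (sub0set A) (cards0 _).
have /(gL 1%N) := hb set0 b0 (sub0set A) (cards0 _) b0A.
rewrite pihomog_Xmul.
have -> : pihomog mdeg 0 (nn set0) = 1.
  apply/mpolyP => m; rewrite mcoeff_pihomog mdeg_eq0 mcoeff1.
  case: eqP => // ->; move: h1 => /(congr1 (mcoeff 0%MM)).
  rewrite /X big_set0 mcoeff1 eqxx mcoeff_kill; case: ifP => [_ -> //|/forall_inPn[v _]].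
  by rewrite mnm0E.
rewrite mulr1 => /kA; rewrite killU (negPf b0A) => /eqP.
by rewrite -msupp_eq0 msuppX.
Qed.

End Graph.

(** * Chains of primes in a polynomial ring *)

Fixpoint box (D k : nat) : seq (seq nat) :=
  if k is k'.+1 then [seq j :: e | j <- iota 0 D, e <- box D k'] else [:: [::]].

Lemma size_box D k : size (box D k) = (D ^ k)%N.
Proof. by elim: k => //= k IH; rewrite size_allpairs size_iota IH expnS. Qed.

Lemma mem_box D k e : (e \in box D k) = (size e == k) && all (fun j => (j < D)%N) e.
Proof.
elim: k e => [|k IH] [|j e] //=.
  by apply/negbTE/allpairsP => -[[i f] /= [_ _]].
rewrite eqSS; apply/allpairsP/idP => [[[i f] /= [hi hf [-> ->]]]|].
  by move: hi hf; rewrite mem_iota IH add0n => /= -> /andP[-> ->].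
move=> /and3P[se jD ae]; exists (j, e); split=> //=; first by rewrite mem_iota.
by rewrite IH se.
Qed.

Lemma uniq_box D k : uniq (box D k).
Proof.
elim: k => //= k IH; apply: allpairs_uniq => //; first exact: iota_uniq.
by move=> [i e] [j f] _ _ /= [-> ->].
Qed.

Section Dimension.
Variables (n : nat) (F : fieldType).
Local Notation S := {mpoly F[n]}.
Implicit Types (xs : seq S) (c : seq nat -> F) (W : {set 'I_n}).

(** Coefficients are functions of the list of exponents, so that fixing the exponent
    of the first variable is partial application. *)
Fixpoint boxpoly D xs c : S :=
  if xs is x :: xs' then \sum_(j < D) x ^+ j * boxpoly D xs' (fun e => c ((j : nat) :: e))
  else (c [::])%:MP.

Fixpoint powers xs (e : seq nat) : S :=
  match xs, e with x :: xs', j :: e' => x ^+ j * powers xs' e' | _, _ => 1 end.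

Lemma boxpolyE D xs c :
  boxpoly D xs c = \sum_(e <- box D (size xs)) c e *: powers xs e.
Proof.
elim: xs c => [|x xs IH] c /=; first by rewrite big_seq1 alg_mpolyC.
rewrite big_allpairs_dep /= (_ : iota 0 D = index_iota 0 D); last first.
  by rewrite /index_iota subn0.
rewrite big_mkord; apply: eq_bigr => j _; rewrite IH mulr_sumr.
by apply: eq_bigr => e _; rewrite -scalerAr.
Qed.

Section Chain.
Variables (P : nat -> {pred S}) (l : nat).
Hypothesis Pprime : forall i, (i <= l)%N -> prime_ideal (P i).
Hypothesis Psub : forall i, (i < l)%N -> {subset P i <= P i.+1}.

Lemma prime_idealD i x y : (i <= l)%N -> x \in P i -> y \in P i -> x + y \in P i.
Proof.
by move=> /Pprime[[_ _ h] _] hx hy; rewrite -[x]mul1r; apply: h.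
Qed.

Lemma prime_idealM i a x : (i <= l)%N -> x \in P i -> a * x \in P i.
Proof.
by move=> /Pprime[[h0 _ h] _] hx; rewrite -[a * x]addr0; apply: h.
Qed.

(** Take x_i in P_(i+1) but not in P_i. If a polynomial relation among the x_i holds
    modulo P_k, divide it by the largest possible power of its first element, which
    is not in P_k, and reduce it modulo P_(k+1): what is left is a relation among
    the other elements. *)
Lemma chain_independent D xs c k : (k + size xs <= l)%N ->
  (forall i, (i < size xs)%N -> xs`_i \in P (k + i).+1 /\ xs`_i \notin P (k + i)) ->
  boxpoly D xs c \in P k -> forall e, e \in box D (size xs) -> c e = 0.
Proof.
elim: xs c k => [|x xs IH] c k /= kl hxs hP e.
  rewrite inE => /eqP ->; apply/eqP; apply: contraT => c0.
  rewrite addn0 in kl; have [[_ /negP h1 _] _] := Pprime kl; case: h1.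
  have -> : 1 = ((c [::])^-1)%:MP * (c [::])%:MP :> S.
    by rewrite -mpolyCM mulVf.
  exact: prime_idealM.
have kl' : (k.+1 + size xs <= l)%N by rewrite addSnnS.
have [x1 x0] : x \in P k.+1 /\ x \notin P k.
  by have := hxs 0%N isT; rewrite addn0.
have hxs' i : (i < size xs)%N -> xs`_i \in P (k.+1 + i).+1 /\ xs`_i \notin P (k.+1 + i).
  by move=> hi; rewrite addSnnS; apply: (hxs i.+1).
have kl0 : (k < l)%N by apply: leq_trans kl'; rewrite leq_addr.
pose z j := forall e, e \in box D (size xs) -> c (j :: e) = 0.
suff H j : (j <= D)%N -> forall i, (i < j)%N -> z i.
  by case/allpairsP => -[j e'] /= [jD he ->]; rewrite mem_iota in jD;
    apply: (H D (leqnn D)).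
elim: j => // j IHj jD i; rewrite ltnS leq_eqVlt => /orP[/eqP ->|];
  last exact: IHj (ltnW jD) _.
have zj := IHj (ltnW jD).
apply: (IH _ k.+1 kl' hxs').
pose b (i : nat) := boxpoly D xs (fun e => c (i :: e)).
have bE : \sum_(i < D) x ^+ i * b i =
  x ^+ j * (b j + x * \sum_(j.+1 <= i < D) x ^+ (i - j.+1) * b i).
  rewrite -(big_mkord xpredT (fun i => x ^+ i * b i)) (big_cat_nat (n := j)) //=;
    last exact: ltnW.
  rewrite big_nat_cond big1 ?add0r; last first.
    move=> i' /andP[/andP[_ ij] _]; rewrite /b boxpolyE big_seq big1 ?mulr0 // => e' he.
    by rewrite (zj i' ij) // scale0r.
  rewrite big_ltn // mulrDr; congr (_ + _); rewrite mulrA mulr_sumr.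
  rewrite big_nat_cond [RHS]big_nat_cond; apply: eq_bigr => i' /andP[/andP[ji _] _].
  by rewrite mulrA -exprSr -exprD addnC subnK.
have xj : x ^+ j \notin P k.
  have [[_ h1 _] pr] := Pprime (ltnW kl0).
  elim: (j) => [|j' h]; first by rewrite expr0.
  by apply/negP; rewrite exprS => /pr; rewrite (negPf x0) (negPf h).
move: hP; rewrite -[X in X \in _]/(\sum_(i < D) x ^+ i * b i) bE.
have [_ pr] := Pprime (ltnW kl0).
move/pr; rewrite (negPf xj) /= => /(Psub kl0) h.
rewrite -[X in X \in _]/(b j) -[b j](addrK (x * \sum_(j.+1 <= i < D) x ^+ (i - j.+1) * b
  i)).
apply: prime_idealD => //; rewrite -mulN1r; apply: prime_idealM => //.
by rewrite mulrC; apply: prime_idealM.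
Qed.

End Chain.

Lemma msizeM_leq (p q : S) : (msize (p * q) <= msize p + msize q)%N.
Proof.
have [->|p0] := eqVneq p 0; first by rewrite mul0r mmeasure0.
have [->|q0] := eqVneq q 0; first by rewrite mulr0 mmeasure0.
by rewrite msizeM // leq_pred.
Qed.

Lemma msize_powers (d D : nat) xs e : {in xs, forall x, (msize x <= d)%N} ->
  {in e, forall j, (j < D)%N} -> (msize (powers xs e) <= (size xs * (D * d).+1).+1)%N.
Proof.
elim: xs e => [|x xs IH] [|j e] hx he /=; rewrite ?msize1 //.
have hj : (msize (x ^+ j) <= (D * d).+1)%N.
  apply: (@leq_trans (j * d).+1).
    elim: (j) => [|k hk]; first by rewrite expr0 msize1.
    rewrite exprS mulSn -addnS; apply: leq_trans (msizeM_leq _ _) _.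
    by rewrite leq_add // hx // mem_head.
  by rewrite ltnS leq_mul2r ltnW ?orbT // he // mem_head.
apply: leq_trans (msizeM_leq _ _) _.
rewrite [(_.+1 * _)%N]mulSn -addnS; apply: leq_add hj (IH _ _ _) => y hy.
  by apply: hx; rewrite inE hy orbT.
by apply: he; rewrite inE hy orbT.
Qed.

(** By counting: for large D, there are more monomials of degree < D in each of l >
    t elements than monomials in the t remaining variables of the degrees that they
    reach. *)
Lemma algebraic_dependence W xs : (#|~: W| < size xs)%N ->
  exists D c, kill W (boxpoly D xs c) = 0 /\
    exists2 e, e \in box D (size xs) & c e != 0.
Proof.
set t := #|~: W| => tx; set l := size xs.
pose d := \max_(x <- xs) msize x.
have hd : {in xs, forall x, (msize x <= d)%N}.
  by move=> x xxs; rewrite /d (big_rem x) //= leq_maxl.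
(* E bounds the degrees of the monomials of degree < D in each element, and E <= D * a;
   so E ^ t < D ^ l follows from a ^ t < D. *)
pose a := (l * d.+1).+1; pose D := (a ^ t).+1; pose E := (l * (D * d).+1).+1.
have cardDE : (E ^ t < D ^ l)%N.
  apply: (@leq_ltn_trans ((D * a) ^ t)).
    have [->//|t0] := posnP t; rewrite leq_exp2r //.
    rewrite (_ : (D * a = D + l * (D + D * d))%N); last first.
      by rewrite -[RHS]/(D + l * (D + D * d))%N -mulnS mulnCA -mulnS.
    by apply: (@leq_add 1) => //; rewrite leq_mul2l (@leq_add 1) ?orbT.
  rewrite expnMn; apply: (@leq_trans (D ^ t.+1)); last exact: leq_pexp2l.
  by rewrite expnSr ltn_pmul2l // expn_gt0.
pose rows := box D l; pose cols := box E t; pose s := enum (~: W).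
have szs : size s = t by rewrite -cardE.
(* The default value of nth provides the exponent 0 of the variables of W. *)
pose mon (e : seq nat) := [multinom nth 0%N e (index v s) | v < n].
pose M := \matrix_(i < D ^ l, j < E ^ t)
  (kill W (powers xs (nth [::] rows i)))@_(mon (nth [::] cols j)).
have kM : kermx M != 0.
  by rewrite -mxrank_eq0 mxrank_ker -lt0n subn_gt0 (leq_ltn_trans (rank_leq_col _)).
pose v := nz_row (kermx M).
have v0 : v != 0 by rewrite nz_row_eq0.
have vM : v *m M = 0 by apply/sub_kermxP; apply: nz_row_sub.
have szr : size rows = (D ^ l)%N by rewrite size_box.
pose c (e : seq nat) : F := if insub (index e rows) is Some i then v 0 i else 0.
have cE (i : 'I_(D ^ l)) : c (nth [::] rows i) = v 0 i.
  by rewrite /c index_uniq ?uniq_box ?szr // valK.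
exists D, c; split; last first.
  have [i vi] : exists i, v 0 i != 0 by apply/rV0Pn.
  exists (nth [::] rows i); last by rewrite cE.
  by rewrite mem_nth ?szr.
rewrite boxpolyE (big_nth [::]) -/l -/rows szr big_mkord raddf_sum /=.
have kE (i : 'I_(D ^ l)) m : (kill W (powers xs (nth [::] rows i)))@_m != 0 ->
    exists j : 'I_(E ^ t), m = mon (nth [::] cols j).
  rewrite mcoeff_kill; case: ifP => [/forall_inP mW|]; last by rewrite eqxx.
  rewrite -mcoeff_msupp => /msize_mdeg_lt mE.
  have mE' v' : (m v' < E)%N.
    apply: leq_ltn_trans (leq_trans mE _); first by rewrite mdegE (bigD1 v') //= leq_addr.
    apply: msize_powers => // j hj.
    have := mem_nth [::] (s := rows) (n := i); rewrite szr ltn_ord mem_box => /(_ isT).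
    by case/andP=> _ /allP; apply.
  have hm : [seq m v' | v' <- s] \in cols.
    by rewrite mem_box size_map szs eqxx; apply/allP => _ /mapP[v' _ ->].
  have ij : (index [seq m v' | v' <- s] cols < E ^ t)%N by rewrite -size_box index_mem.
  exists (Ordinal ij); rewrite nth_index //; apply/mnmP => v'; rewrite mnmE.
  have [v's|v's] := boolP (v' \in s); first by rewrite (nth_map v') ?index_mem // nth_index.
  rewrite nth_default ?size_map; last by rewrite leqNgt index_mem.
  by apply/eqP/mW; move: v's; rewrite mem_enum inE negbK.
apply/mpolyP => m; rewrite mcoeff0 raddf_sum /=.
have [[j mj]|nj] := pselect (exists j : 'I_(E ^ t), m = mon (nth [::] cols j)); last first.
  rewrite big1 // => i _; rewrite linearZ /= mcoeffZ; apply/eqP; rewrite mulf_eq0.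
  by apply/orP; right; apply: contraT => /kE.
have := congr1 (fun x : 'rV_(E ^ t) => x 0 j) vM; rewrite !mxE => h; rewrite -[RHS]h.
by apply: eq_bigr => i _; rewrite linearZ /= mcoeffZ cE mxE mj.
Qed.

Lemma prime_chain_le W (P : nat -> {pred S}) l :
  (forall i, (i <= l)%N -> prime_ideal (P i)) ->
  (forall i, (i < l)%N ->
    {subset P i <= P i.+1} /\ (exists2 a, a \in P i.+1 & a \notin P i)) ->
  (forall f, kill W f = 0 -> f \in P 0%N) -> (l <= #|~: W|)%N.
Proof.
move=> Pp Ps P0; rewrite leqNgt; apply/negP => tl.
have /choice[x hx] : forall i, exists x, (i < l)%N -> x \in P i.+1 /\ x \notin P i.
  move=> i; case: (ltnP i l) => [/Ps[_ [a a1 a0]]|_]; last by exists 0.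
  by exists a.
have [|D [c [kc [e he ce]]]] := @algebraic_dependence W (mkseq x l).
  by rewrite size_mkseq.
have := @chain_independent P l Pp (fun i il => proj1 (Ps i il)) D (mkseq x l) c 0%N.
rewrite size_mkseq => /(_ (leqnn l)) H; case/eqP: ce; apply: H => //.
- by move=> i il; rewrite nth_mkseq //; apply: hx.
- exact: P0.
- by rewrite size_mkseq in he.
Qed.

End Dimension.

(** * Star graphs *)

(** Q is cyclic, generated by the class of u, and the annihilator of u is the
    monomial prime of W.  All this is expressed through A and B, since depth is
    computed by Koszul cohomology relative to them. *)
Section CyclicCM.
Variables (n : nat) (F : fieldType).
Local Notation S := {mpoly F[n]}.
Variables (Q : lmodType S) (A B : S^o -> Prop) (pi : S^o -> Q) (u : S) (W : {set 'I_n}).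
Hypothesis hpi : presents A B pi.
Hypothesis gA : is_homog A.
Hypothesis gB : is_homog B.
Hypothesis uA : A u.
Hypothesis uB : forall f : S, B (f * u) <-> kill W f = 0.
Hypothesis uG : forall x, A x -> exists f : S, B (x - f * u).

Let t := #|~: W|.
Let hA := pres_A hpi.
Let hB := pres_B hpi.

Lemma cyclic_A (f : S) : A (f * u).
Proof. exact: (is_submodZ f hA). Qed.

Lemma cyclic_proj (q : Q) : exists f : S, pi (f * u) = q.
Proof.
have [x Ax <-] := pres_surj hpi q; have [f hf] := uG Ax; exists f.
apply/eqP; rewrite eq_sym -subr_eq0 -(presB hpi) //; last exact: cyclic_A.
by case/(pres_ker hpi): hf => _ ->.
Qed.

Lemma cyclic_projZ a (f : S) : a *: pi (f * u) = pi (a * f * u).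
Proof.
rewrite -(presZ hpi); last exact: cyclic_A.
by congr (pi _); exact: mulrA.
Qed.

Lemma cyclic_annihilates a : annihilates Q a <-> kill W a = 0.
Proof.
rewrite (pres_annihilates hpi); split=> [h|ka x /uG[f hf]].
  by apply/uB; apply: (h u).
have h1 := is_submodZ a hB hf.
have h2 : B (a * f * u) by apply/uB; rewrite rmorphM /= ka mul0r.
have E : a * (x : S) = a * ((x : S) - f * u) + a * f * u by rewrite mulrBr mulrA subrK.
by have := is_submodD hB h1 h2; rewrite -[X in B X]/(a * ((x : S) - f * u) + a * f * u) -E.
Qed.

Lemma cyclic_krull_dim : krull_dim Q t.
Proof.
split; first by apply: (@killed_chain n F) => a; rewrite cyclic_annihilates.
move=> l P [hP1 hP2]; apply: (@prime_chain_le n F W P l) => //.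
- by move=> i /hP1[].
- move=> f kf; have [_] := hP1 0%N isT; apply; exact/cyclic_annihilates.
Qed.

Let vs := enum (~: W).

Lemma cyclic_in_ideal i (f : S) : (i <= size vs)%N ->
  in_ideal_mul (take i (vars F vs)) (pi (f * u)) <->
  kill (W :|: [set v in take i vs]) f = 0.
Proof.
elim: i f => [|i IH] f hi.
  rewrite take0 in_ideal_mul_nil (_ : _ :|: _ = W); last first.
    by apply/setP => v; rewrite !inE take0 orbF.
  rewrite -uB (pres_ker hpi); split=> [h|[]//]; split=> //; exact: cyclic_A.
have v0 : 'I_n by case: vs hi.
have sX : (i < size (vars F vs))%N by rewrite size_map.
rewrite (take_nth 0 sX) in_ideal_mul_rcons (nth_map v0) //; set v := nth v0 vs i.
have WE : W :|: [set w in take i.+1 vs] = [set v] :|: (W :|: [set w in take i vs]).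
  by apply/setP => w; rewrite (take_nth v0 hi) !inE mem_rcons inE orbCA.
have piE g : pi (f * u) - 'X_v *: pi (g * u) = pi ((f - g * 'X_v) * u).
  rewrite cyclic_projZ -(presB hpi); try exact: cyclic_A.
  by congr (pi _); rewrite mulrBl [g * _]mulrC.
rewrite WE; split=> [[y]|kf].
  have [g <-] := cyclic_proj y; rewrite piE IH ?(ltnW hi) // => h.
  rewrite -kill_kill -[f](subrK (g * 'X_v)) raddfD /= h add0r.
  rewrite kill_kill rmorphM /= killU !inE eqxx mulr0 //.
have [g hg] := kill_sub [set v] f.
exists (pi (g v * u)); rewrite piE IH ?(ltnW hi) //.
have -> : f - g v * 'X_v = kill [set v] f.
  by rewrite -[f in LHS](subrK (kill [set v] f)) hg big_set1 addrC addrA addNr add0r.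
by rewrite kill_kill setUC.
Qed.

(** The variables outside W form a regular sequence. A longer one would make the
    t-th Koszul cohomology of all the variables vanish; dropping the t variables
    outside W, the cohomology of degree 0 over the variables of W would vanish too,
    but it contains the class of u. *)
Lemma cyclic_depth : depth Q t.
Proof.
split.
  exists (vars F vs); last by rewrite size_map -cardE.
  split; first by apply/allP => _ /mapP[v _ ->]; rewrite /= mcoeffX eq_sym mnm1_eq0.
  rewrite /regular_sequence size_map; split=> [i hi q|].
    have [f <-] := cyclic_proj q.
    have v0 : 'I_n by case: vs hi.
    rewrite (nth_map v0) // cyclic_projZ !cyclic_in_ideal ?(ltnW hi) //.
    rewrite rmorphM /= killU ifF => [/eqP|].
      by rewrite mulf_eq0 -msupp_eq0 msuppX => /eqP.
    have vW : nth v0 vs i \in ~: W by rewrite -mem_enum mem_nth.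
    rewrite !inE in vW *; rewrite (negPf vW) /=; apply/negP => vt.
    have := enum_uniq (~: W); rewrite -/vs -{1}(cat_take_drop i vs) cat_uniq.
    case/and3P=> _ /hasPn h _; have := h (nth v0 vs i).
    by rewrite (drop_nth v0) // mem_head vt => /(_ isT).
  exists (pi u); rewrite -[vars F vs]take_size size_map -[u]mul1r cyclic_in_ideal //.
  by move/eqP; rewrite rmorph1 oner_eq0.
move=> a [/allP a0 rega]; rewrite leqNgt; apply/negP => ta.
have ps : perm_eq (vs ++ enum W) (enum 'I_n).
  apply: uniq_perm => [||v]; rewrite ?enum_uniq //.
    rewrite cat_uniq !enum_uniq andbT; apply/hasPn => v.
    by rewrite !mem_enum inE negbK.
  by rewrite mem_cat !mem_enum !inE orNb.
have vt : kvanish (vars F (vs ++ enum W)) A B t.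
  apply: (kvanish_regular_sequence hpi rega) => // b /a0 /eqP b0; exact: vars_gen.
have v0 : kvanish (vars F (enum W)) A B 0.
  by apply: (@kvanish_drops _ _ vs) => //; rewrite -cardE addn0.
have [w|w hw|w sw|g [_ dg /(_ (nseq (size (enum W)) false))]] := v0 (cochain0 (u : S^o)).
- by rewrite /cochain0; case: ifP => // _; case: hA.
- by rewrite /cochain0; case: eqP => // e; case: hw; rewrite e.
- rewrite kdiff_cochain0; last by rewrite sw size_map.
  apply: cochain1_in => // v; rewrite mem_enum => vW.
  by apply/uB; rewrite killU vW.
rewrite size_nseq size_map => /(_ erefl).
rewrite (_ : g = fun=> 0) ?kdiff0 ?subr0; last by apply/funext => w; apply: dg.
rewrite /cochain0 count_nseq /= -[u]mul1r => /uB/eqP.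
by rewrite rmorph1 oner_eq0.
Qed.

Lemma cyclic_CM : cohen_macaulay Q.
Proof. by exists t; [exact: cyclic_krull_dim | exact: cyclic_depth]. Qed.

End CyclicCM.

Section Filtrations.
Variables (n : nat) (F : fieldType) (I : submodClosed ({mpoly F[n]}^o)).
Hypothesis homI : homogeneous_ideal I.
Local Notation S := {mpoly F[n]}.
Variable J : S^o -> Prop.
Hypothesis hJ : is_submod J.
Hypothesis IJ : forall f, f \in I -> J f.

Lemma submod_of_ideal : exists N : submodClosed (quotmod I),
  forall f : S^o, quotmod_proj I f \in N <-> J f.
Proof.
pose N : {pred quotmod I} := fun q => `[< J (quotmod_repr q) >].
have NE f : quotmod_proj I f \in N <-> J f.
  rewrite -[_ \in _]/(`[< J (quotmod_repr (quotmod_proj I f)) >]).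
  have h : J (quotmod_repr (quotmod_proj I f) - f).
    by apply: IJ; apply/quotmod_projE; apply: quotmod_reprK.
  split=> [/asboolP h1|h1].
    by have := is_submodB hJ h1 h; rewrite opprB addrC subrK.
  by apply/asboolP; have := is_submodD hJ h h1; rewrite subrK.
have N_closed : GRing.subsemimod_closed N.
  have NZ a x : x \in N -> a *: x \in N.
    rewrite -[x]quotmod_reprK -linearZ !NE; exact: is_submodZ.
  split=> [|a x]; last exact: NZ.
  split=> [|x y]; first by rewrite -(raddf0 (quotmod_proj I)) NE; case: hJ.
  rewrite -[x]quotmod_reprK -[y]quotmod_reprK -raddfD !NE; exact: is_submodD.
pose N' : submodClosed (quotmod I) :=
  HB.pack N (GRing.isSubmodClosed.Build S (quotmod I) N N_closed).
by exists N'.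
Qed.

Lemma graded_submod_of_homog (N : submodClosed (quotmod I)) :
  (forall f : S^o, quotmod_proj I f \in N <-> J f) -> is_homog J ->
  graded_submod (quot_grading homI) N.
Proof.
move=> NE gJ x Nx; pose f : S := quotmod_repr x.
have xE : quotmod_proj I f = x by exact: quotmod_reprK.
have Jf : J f by apply/NE; rewrite xE.
exists (map Posz (iota 0 (msize f))).
exists (fun d => if d is Posz e then quotmod_proj I (pihomog mdeg e f) else 0).
split=> [[e|e]|].
- split; last by apply/NE; apply: gJ.
  apply/asboolP; exists (pihomog mdeg e f); split=> // m.
  by move/(dhomog_mf (pihomogP mdeg e f)) => ->.
- by split; [case: (gr_zmod (quot_grading homI) (Negz e)) | exact: rpred0].
rewrite big_map (_ : iota 0 _ = index_iota 0 (msize f)); last first.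
  by rewrite /index_iota subn0.
rewrite big_mkord -raddf_sum.
by rewrite -(pihomog_partitionE (leqnn _)); exact: esym xE.
Qed.

End Filtrations.

Section Star.
Variables (n : nat) (F : fieldType) (e : rel 'I_n) (c : 'I_n).
Local Notation S := {mpoly F[n]}.
Local Notation I := (edge_ideal (F:=F) e).
Hypothesis eE : forall u v, e u v = (u == c) (+) (v == c).
Hypothesis leaves : (1 < #|~: [set c]|)%N.

Lemma killed_homog (W : {set 'I_n}) : is_homog (fun f : S^o => kill W f = 0).
Proof. by move=> d f /= kf; rewrite -pihomog_kill kf pihomog0. Qed.

(** The filtration 0, (X_c) / I, S / I: its first quotient is generated by X_c,
    whose annihilator consists of the leaves, and its second one by 1, with
    annihilator (X_c). *)
Lemma star_SCM : sequentially_CM (edge_grading F e).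
Proof.
pose J0 (f : S^o) : Prop := f \in I.
pose J1 (f : S^o) : Prop := kill [set c] f = 0.
pose J2 (f : S^o) : Prop := True.
have hJ0 : is_submod J0.
  split=> [|a x y hx hy]; first exact: (@rpred0 S^o).
  by apply: (@rpredD S^o) => //; apply: (@rpredZ _ S^o).
have hJ1 : is_submod J1 by exact: killed_submod.
have hJ2 : is_submod J2 by [].
have IJ1 f : f \in I -> J1 f.
  apply: edge_ideal_kill => u v; rewrite eE !inE.
  by case: (u == c).
have kY f : f \in I -> kill (~: [set c]) f = 0.
  apply: edge_ideal_kill => u v; rewrite eE !inE.
  by case: (u == c); case: (v == c).
have gJ0 : is_homog J0 by move=> d f; apply: edge_ideal_homog.
have gJ1 : is_homog J1 by exact: killed_homog.
have gJ2 : is_homog J2 by [].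
have [N0 hN0] := @submod_of_ideal n F I J0 hJ0 (fun _ h => h).
have [N1 hN1] := @submod_of_ideal n F I J1 hJ1 IJ1.
have [N2 hN2] := @submod_of_ideal n F I J2 hJ2 (fun _ _ => Logic.I).
have E0 : preim_submod N0 = J0 by apply/funext => f; apply/propext; apply: hN0.
have E1 : preim_submod N1 = J1 by apply/funext => f; apply/propext; apply: hN1.
have E2 : preim_submod N2 = J2 by apply/funext => f; apply/propext; apply: hN2.
have s01 : {subset N0 <= N1}.
  by move=> q; rewrite -[q]quotmod_reprK => /hN0 h; apply/hN1/IJ1.
have s12 : {subset N1 <= N2}.
  by move=> q; rewrite -[q]quotmod_reprK => _; apply/hN2.
have p1 := presents_subquot s01; have p2 := presents_subquot s12.
rewrite E0 E1 in p1; rewrite E1 E2 in p2.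
have u1 : J1 'X_c by rewrite /J1 killU inE eqxx.
have b1 (f : S) : J0 (f * 'X_c) <-> kill (~: [set c]) f = 0.
  split=> [/kY|kf].
    rewrite rmorphM /= killU !inE eqxx /= => /eqP.
    by rewrite mulf_eq0 -[X in _ || X]msupp_eq0 msuppX orbF => /eqP.
  have [g] := kill_sub (~: [set c]) f; rewrite kf subr0 => ->.
  rewrite mulr_suml; apply: (@rpred_sum S^o) => v; rewrite !inE => vc.
  rewrite -mulrA mulrC; apply: (@edge_ideal_mem n F e).
  by rewrite eE eqxx (negPf vc).
have g1 x : J1 x -> exists f : S, J0 (x - f * 'X_c).
  move=> kx; have [g] := kill_sub [set c] x;
    rewrite (kx : kill _ _ = 0) subr0 big_set1 => hg.
  by exists (g c); rewrite [X in X - _]hg subrr; case: hJ0.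
have b2 (f : S) : J1 (f * 1) <-> kill [set c] f = 0 by rewrite mulr1.
have g2 x : J2 x -> exists f : S, J1 (x - f * 1).
  by move=> _; exists x; rewrite mulr1 subrr; case: hJ1.
exists 2%N, (fun i => match i with 0 => N0 | 1 => N1 | _ => N2 end); split.
- move=> q /=; rewrite -[q]quotmod_reprK inE; apply/idP/eqP => [/hN0|/quotmod_proj0/hN0 //].
  by move=> h; apply/quotmod_proj0.
- by move=> q; rewrite -[q]quotmod_reprK inE; apply/hN2.
- case=> [|[|[|//]]] _; [exact: (graded_submod_of_homog _ hN0) |
    exact: (graded_submod_of_homog _ hN1) | exact: (graded_submod_of_homog _ hN2)].
- case=> [|[|//]] _; split=> //.
    exact: (cyclic_CM p1 gJ1 gJ0 u1 b1 g1).
  exact: (cyclic_CM p2 gJ2 gJ1 _ b2 g2).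
- case=> [|//] _; exists #|~: ~: [set c]|, #|~: [set c]|; split.
  + exact: (cyclic_krull_dim p1 u1 b1 g1).
  + exact: (cyclic_krull_dim p2 _ b2 g2).
  + by rewrite setCK cards1.
Qed.

End Star.

(** * Zeros of ideals in the affine plane *)

Section Nullstellensatz.
Variable K : closedFieldType.
Local Notation T := {poly {poly K}}.
Implicit Types (J : T -> Prop) (h u v s : T).

Definition is_ideal J := J 0 /\ forall a h k, J h -> J k -> J (a * h + k).

Lemma is_idealM J a h : is_ideal J -> J h -> J (a * h).
Proof. by case=> J0 hJ Jh; rewrite -[_ * _]addr0; apply: hJ. Qed.

Lemma is_idealD J h k : is_ideal J -> J h -> J k -> J (h + k).
Proof. by case=> J0 hJ Jh Jk; rewrite -[h]mul1r; apply: hJ. Qed.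

Definition ideal_adjoin J s h := exists k, J (h - k * s).

Lemma ideal_adjoin_ideal J s : is_ideal J -> is_ideal (ideal_adjoin J s).
Proof.
move=> hJ; split=> [|a h k [u hu] [v hv]].
  by exists 0; rewrite mul0r subrr; case: hJ.
exists (a * u + v).
have -> : a * h + k - (a * u + v) * s = a * (h - u * s) + (k - v * s) by ring.
by case: hJ => _; apply.
Qed.

(** If 1 is in J + (s) for all s in r, then 1 is in J + (product of r), that is, in
    J. *)
Lemma proper_adjoin J (r : seq T) : is_ideal J -> ~ J 1 -> J (\prod_(s <- r) s) ->
  exists s, s \in r /\ ~ ideal_adjoin J s 1.
Proof.
move=> hJ J1 Jr; apply: contrapT => hr.
have {}hr s : s \in r -> ideal_adjoin J s 1.
  by move=> sr; apply: contrapT => h; apply: hr; exists s.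
have [k hk] : exists k, J (1 - k * \prod_(s <- r) s).
  elim: r {Jr} hr => [|s r IH] hr.
    by exists 1; rewrite big_nil mulr1 subrr; case: hJ.
  have [|k hk] := IH; first by move=> t tr; apply: hr; rewrite inE tr orbT.
  have [l hl] := hr s (mem_head _ _).
  exists (k * l); rewrite big_cons.
  set p := \prod_(_ <- _) _.
  have -> : 1 - k * l * (s * p) = k * p * (1 - l * s) + (1 - k * p) by ring.
  by case: hJ => _; apply.
apply: J1; rewrite -(subrK (k * \prod_(s <- r) s) 1).
by apply: is_idealD => //; apply: is_idealM.
Qed.

Definition eval2 (a b : K) h : K := h.[b%:P].[a].
(** The restriction of h to the line x = a, where x is the inner variable. *)
Definition fiber (a : K) h : {poly K} := map_poly (horner_eval a) h.

Lemma eval2E a b h : eval2 a b h = (fiber a h).[b].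
Proof. by rewrite /eval2 /fiber -[in RHS](hornerC b a) -[in RHS]/(horner_eval a b%:P)
  horner_map. Qed.

Lemma eval2D a b h k : eval2 a b (h + k) = eval2 a b h + eval2 a b k.
Proof. by rewrite /eval2 !hornerD. Qed.

Lemma eval2N a b h : eval2 a b (- h) = - eval2 a b h.
Proof. by rewrite /eval2 !hornerN. Qed.

Lemma eval2M a b h k : eval2 a b (h * k) = eval2 a b h * eval2 a b k.
Proof. by rewrite /eval2 !hornerM. Qed.

Lemma fiber_mod a h : exists k, h = map_poly polyC (fiber a h) + k * ('X - a%:P)%:P.
Proof.
elim/poly_ind: h => [|h c [k hk]].
  by exists 0; rewrite /fiber !rmorph0 mul0r addr0.
have [l hl] : exists l, c = (c.[a])%:P + l * ('X - a%:P).
  have /factor_theorem[l hl] : root (c - (c.[a])%:P) a.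
    by rewrite /root hornerD hornerN hornerC subrr.
  by exists l; rewrite -hl addrC subrK.
exists (k * 'X + l%:P); rewrite /fiber !rmorphD !rmorphM /= !map_polyX !map_polyC /=.
have cE : c%:P = (c.[a])%:P%:P + l%:P * ('X - a%:P)%:P :> T.
  by rewrite -polyCM -polyCD -hl.
rewrite -/(fiber a h) {1}hk cE /horner_eval; ring.
Qed.

(** A univariate polynomial of J splits, so that one of its linear factors can be
    adjoined to J. The morphism g covers both variables of the plane. *)
Lemma split_in_ideal J (r : {poly K}) (g : {poly K} -> T) :
  (forall p q, g (p * q) = g p * g q) -> g 1 = 1 ->
  is_ideal J -> ~ J 1 -> r != 0 -> J (g r) ->
  exists a, ~ ideal_adjoin J (g ('X - a%:P)) 1.
Proof.
move=> gM g1 hJ J1 r0 Jr.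
have [rs rE] := closed_field_poly_normal r.
have lr : lead_coef r != 0 by rewrite lead_coef_eq0.
have [|s [/mapP[a _ ->] hs]] := @proper_adjoin J [seq g ('X - a%:P) | a <- rs] hJ J1.
  rewrite big_map.
  have -> : \prod_(j <- rs) g ('X - j%:P) = g (\prod_(j <- rs) ('X - j%:P)).
    by elim: (rs) => [|j l IH]; rewrite ?big_nil ?g1 // !big_cons gM IH.
  have -> : \prod_(j <- rs) ('X - j%:P) = ((lead_coef r)^-1)%:P * r.
    by rewrite {2}rE mul_polyC scalerA mulVf // scale1r.
  by rewrite gM; apply: is_idealM.
by exists a.
Qed.

(** The eliminant q gives a first coordinate a such that J + (x - a) is proper.
    Modulo x - a, either J vanishes, and the second coordinate is arbitrary, or it
    contains a nonzero polynomial in the second variable, to be treated as q was. *)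
Lemma nullstellensatz J (q : {poly K}) : is_ideal J -> ~ J 1 -> q != 0 -> J q%:P ->
  exists a b, forall h, J h -> eval2 a b h = 0.
Proof.
move=> hJ J1 q0 Jq.
have [||a ha] := @split_in_ideal J q polyC _ _ hJ J1 q0 Jq.
- by move=> p r; rewrite polyCM.
- by rewrite polyC1.
set J' := ideal_adjoin J _ in ha.
have hJ' : is_ideal J' by apply: ideal_adjoin_ideal.
have [h0|] := pselect (forall h, J h -> fiber a h = 0).
  by exists a, 0 => h /h0 e; rewrite eval2E e horner0.
move=> /existsNP[h0 /not_implyP[Jh0 /eqP r0]].
have fiberJ' h : J h -> J' (map_poly polyC (fiber a h)).
  move=> Jh; have [k hk] := fiber_mod a h; exists (- k).
  by rewrite mulNr opprK -hk.
have [||b hb] := @split_in_ideal J' (fiber a h0) (map_poly polyC) _ _ hJ' ha r0 (fiberJ'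
  _ Jh0).
- by move=> p r; rewrite rmorphM.
- by rewrite rmorph1.
rewrite rmorphB /= map_polyX map_polyC /= in hb.
exists a, b => h /fiberJ' Jh; apply/eqP; apply: contraT => e0; case: hb.
have hJ2 : is_ideal (ideal_adjoin J' ('X - b%:P%:P)) by apply: ideal_adjoin_ideal.
have [k hk] : exists k, map_poly polyC (fiber a h) =
  (eval2 a b h)%:P%:P + k * ('X - b%:P%:P) :> T.
  have /factor_theorem[l hl] : root (fiber a h - ((fiber a h).[b])%:P) b.
    by rewrite /root hornerD hornerN hornerC subrr.
  exists (map_poly polyC l); rewrite -[b%:P%:P](map_polyC polyC) -[X in _ - X]/(map_poly
    polyC b%:P).
  rewrite -[X in X - _](map_polyX polyC) -rmorphB -rmorphM /= -hl eval2E.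
  by rewrite rmorphB /= map_polyC /= addrC subrK.
have hc : ideal_adjoin J' ('X - b%:P%:P) (eval2 a b h)%:P%:P.
  by exists (- k); rewrite mulNr opprK -hk.
have -> : 1 = ((eval2 a b h)^-1)%:P%:P * (eval2 a b h)%:P%:P :> T.
  by rewrite -!polyCM mulVf.
exact: is_idealM.
Qed.

(** The resultant, unless f and g have a common factor of positive degree; but the
    zeros of such a factor have infinitely many first coordinates. *)
Lemma eliminant (f g : T) (a0 : K) : f != 0 -> g != 0 ->
  (forall a b, eval2 a b f = 0 -> eval2 a b g = 0 -> a = a0) ->
  exists q u v, q != 0 /\ q%:P = u * f + v * g.
Proof.
move=> f0 g0 fg.
have [/size1_polyC fE|sf] := leqP (size f) 1.
  by exists f`_0, 1, 0; rewrite mul1r mul0r addr0 -fE -polyC_eq0 -fE.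
have [/size1_polyC gE|sg] := leqP (size g) 1.
  by exists g`_0, 0, 1; rewrite mul1r mul0r add0r -gE -polyC_eq0 -gE.
have [r0|r0] := eqVneq (resultant f g) 0; last first.
  have [[u v] /= _ e] := resultant_in_ideal sf sg.
  by exists (resultant f g), u, v.
have := resultant_eq0 f g; rewrite r0 eqxx => /esym sp.
set p := gcdp f g in sp.
have p0 : p != 0 by rewrite -size_poly_gt0 ltnW.
have /Pdiv.Idomain.dvdpP[[c w] /= c0 cE] := dvdp_gcdl f g.
have /Pdiv.Idomain.dvdpP[[c' w'] /= c0' cE'] := dvdp_gcdr f g.
rewrite -/p in cE cE'.
have : c * c' * lead_coef p * ('X - a0%:P) != 0.
  by rewrite !mulf_neq0 ?lead_coef_eq0 ?polyXsubC_eq0.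
move/closed_nonrootP=> [a]; rewrite /root !hornerM !mulf_eq0 !negb_or.
case/andP=> /andP[/andP[ca ca'] pa]; rewrite !hornerE subr_eq0 => aa.
have sp' : size (fiber a p) != 1%N.
  by rewrite /fiber size_map_poly_id0 // neq_ltn sp orbT.
have /closed_rootP[b /eqP rb] := sp'.
have pab : eval2 a b p = 0 by rewrite eval2E.
have zero c1 w1 k : c1.[a] != 0 -> c1 *: k = w1 * p -> eval2 a b k = 0.
  move=> c1a /(congr1 (eval2 a b)); rewrite eval2M pab mulr0 /eval2 hornerZ hornerM => /eqP.
  by rewrite mulf_eq0 (negPf c1a) => /eqP.
by case/eqP: aa; apply: (fg a b); [apply: (zero c w)|apply: (zero c' w')].
Qed.

(** The colon ideal J of (f, g) by x - a0 has no zero. A zero of J would be (a0,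
    b0), but by Cramer's rule J contains u1 v2 - v1 u2, whose value there is the
    Jacobian determinant. Hence 1 is in J. *)
Lemma simple_zero_in_ideal (f g : T) a0 b0 : f != 0 -> g != 0 ->
  (forall a b, eval2 a b f = 0 -> eval2 a b g = 0 -> a = a0 /\ b = b0) ->
  (eval2 a0 b0 f = 0 -> eval2 a0 b0 g = 0 -> exists u1 v1 u2 v2,
     [/\ f = ('X - a0%:P)%:P * u1 + ('X - b0%:P%:P) * v1,
         g = ('X - a0%:P)%:P * u2 + ('X - b0%:P%:P) * v2 &
         eval2 a0 b0 (u1 * v2 - v1 * u2) != 0]) ->
  exists u v, ('X - a0%:P)%:P = u * f + v * g.
Proof.
move=> f0 g0 fg jac.
pose J h := exists u v, ('X - a0%:P)%:P * h = u * f + v * g.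
have hJ : is_ideal J.
  split=> [|a h k [u [v e1]] [u' [v' e2]]].
    by exists 0, 0; rewrite mulr0 !mul0r addr0.
  exists (a * u + u'), (a * v + v').
  have -> : ('X - a0%:P)%:P * (a * h + k) =
    a * (('X - a0%:P)%:P * h) + ('X - a0%:P)%:P * k by ring.
  rewrite e1 e2; ring.
have [[u [v]]|J1] := pselect (J 1); first by rewrite mulr1 => e; exists u, v.
have [a b /fg /[apply] -[]//|q [u [v [q0 qE]]]] := @eliminant f g a0 f0 g0.
have Jfg u' v' : J (u' * f + v' * g).
  exists (('X - a0%:P)%:P * u'), (('X - a0%:P)%:P * v'); ring.
have Jq : J q%:P by rewrite qE.
have [a [b zJ]] := nullstellensatz hJ J1 q0 Jq.
have fz : eval2 a b f = 0 by apply: zJ; have := Jfg 1 0; rewrite mul1r mul0r addr0.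
have gz : eval2 a b g = 0 by apply: zJ; have := Jfg 0 1; rewrite mul1r mul0r add0r.
have [ea eb] := fg a b fz gz; rewrite {}ea {}eb in zJ fz gz.
have [u1 [v1 [u2 [v2 [fE gE]]]]] := jac fz gz.
rewrite zJ ?eqxx //; exists v2, (- v1); rewrite fE gE; ring.
Qed.

End Nullstellensatz.

(** * Ternary forms in an affine chart and on a line *)

Section General.
Variables (n : nat) (R : idomainType).
Implicit Types (f g : {mpoly R[n]}).

Lemma mpoly_closure_ind (H : {mpoly R[n]} -> Prop) :
  (forall c, H c%:MP) -> (forall i, H 'X_i) ->
  (forall f g, H f -> H g -> H (f + g)) -> (forall f g, H f -> H g -> H (f * g)) ->
  forall f, H f.
Proof.
move=> hC hX hD hM; elim/mpolyind => [|c m p _ _ Hp]; first by rewrite -mpolyC0.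
apply: (hD) => //; rewrite -mul_mpolyC; apply: (hM) => //.
have h1 : H 1 by rewrite -mpolyC1.
rewrite mpolyXE_id; apply: big_ind => // i _.
by elim: (m i) => [|k IH]; rewrite ?expr0 // exprS; apply: hM.
Qed.

Lemma mpoly_taylor1 (v : 'I_n -> R) f :
  exists u : 'I_n -> {mpoly R[n]},
    f = (f.@[v])%:MP + \sum_i u i * ('X_i - (v i)%:MP).
Proof.
elim/mpoly_closure_ind: f => [c|i|f g [u hu] [w hw]|f g [u hu] [w hw]].
- exists (fun=> 0); rewrite mevalC big1 ?addr0 // => i _; by rewrite mul0r.
- exists (fun j => (j == i)%:R); rewrite mevalXU (bigD1 i) //= eqxx mul1r big1.
    by rewrite addr0 addrC subrK.
  by move=> j /negPf ->; rewrite mul0r.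
- exists (fun i => u i + w i); rewrite mevalD mpolyCD {1}hu {1}hw.
  rewrite (eq_bigr _ (fun i _ => mulrDl _ _ _)) big_split /=; ring.
- exists (fun i => u i * g + (f.@[v])%:MP * w i); rewrite mevalM mpolyCM.
  have -> : \sum_i (u i * g + (f.@[v])%:MP * w i) * ('X_i - (v i)%:MP) =
     (\sum_i u i * ('X_i - (v i)%:MP)) * g + (f.@[v])%:MP * \sum_i w i * ('X_i - (v i)%:MP).
    rewrite mulr_suml mulr_sumr -big_split /=; apply: eq_bigr => i _; ring.
  have -> : \sum_i u i * ('X_i - (v i)%:MP) = f - (f.@[v])%:MP by apply/eqP;
    rewrite eq_sym subr_eq addrC; apply/eqP.
  have -> : \sum_i w i * ('X_i - (v i)%:MP) = g - (g.@[v])%:MP by apply/eqP;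
    rewrite eq_sym subr_eq addrC; apply/eqP.
  ring.
Qed.

Lemma mderiv_taylor1 (v : 'I_n -> R) f (u : 'I_n -> {mpoly R[n]}) i :
  f = (f.@[v])%:MP + \sum_i u i * ('X_i - (v i)%:MP) -> (f^`M(i)).@[v] = (u i).@[v].
Proof.
move=> ->; rewrite mderivD mderivC add0r (raddf_sum (mderiv i)) (raddf_sum (meval v)) /=.
rewrite (bigD1 i) //= big1 => [|j ji]; rewrite mderivM mderivB mderivC subr0 mderivX.
  rewrite mevalD !mevalM mevalB mevalXU mevalC subrr mulr0 add0r mevalZ mnm1E eqxx mul1r.
  by rewrite (_ : (U_(i) - U_(i))%MM = 0%MM) ?mpolyX0 ?meval1 ?mulr1 ?addr0 //;
     apply/mnmP => k; rewrite mnmBE mnm0E subnn.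
by rewrite mevalD !mevalM mevalB mevalXU mevalC subrr mulr0 add0r mevalZ mnm1E (negPf ji)
  mul0r mulr0.
Qed.

Lemma meval_scale d f c (v : 'I_n -> R) : f \is d.-homog ->
  f.@[fun i => c * v i] = c ^+ d * f.@[v].
Proof.
move=> /dhomogP hf; rewrite !mevalE mulr_sumr; apply: eq_big_seq => m /hf md.
rewrite mulrCA; congr (_ * _).
rewrite -md /= mdegE -prodrXr -big_split /=.
by apply: eq_bigr => i _; rewrite exprMn.
Qed.

Lemma mderiv_homog d f i : f \is d.+1.-homog -> f^`M(i) \is d.-homog.
Proof.
move=> /dhomogP hf; apply/dhomogP => m; rewrite mcoeff_msupp mcoeff_deriv => h.
have /hf : (m + U_(i))%MM \in msupp f.
  by rewrite mcoeff_msupp; apply: contraNneq h => ->; rewrite mul0rn.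
by rewrite /= mdegD mdeg1 addn1 => -[].
Qed.

Lemma euler d f (v : 'I_n -> R) : f \is d.-homog ->
  \sum_i v i * (f^`M(i)).@[v] = d%:R * f.@[v].
Proof.
move=> /dhomogP hf.
rewrite {2}[f]mpolyE (raddf_sum (meval v)) /= mulr_sumr.
under eq_bigr => i _.
  rewrite {1}[f]mpolyE (raddf_sum (mderiv i)) (raddf_sum (meval v)) /= mulr_sumr.
over.
rewrite exchange_big /=; apply: eq_big_seq => m /hf /= md.
under eq_bigr => i _ do rewrite linearZ /= mevalZ mulrCA.
rewrite -mulr_sumr mevalZ mulrCA; congr (_ * _).
rewrite -md mdegE natr_sum mulr_suml; apply: eq_bigr => i _.
rewrite mderivX mevalZ mulrCA.
have [->|mi] := eqVneq (m i) 0%N; first by rewrite !mul0r.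
congr (_ * _); rewrite -(mevalXU v i) -mevalM -mpolyXD addmC submK //.
by rewrite lep1mP.
Qed.

End General.

Section Chart.
Variables (K : closedFieldType) (x y z : 'I_3).
Hypothesis xyz : uniq [:: x; y; z].
Local Notation S := {mpoly K[3]}.
Local Notation T := {poly {poly K}}.
Implicit Types (f g U V : S).

Lemma neq_xyz : [/\ x != y, x != z & y != z].
Proof. by move: xyz; rewrite /= !inE negb_or andbT => /andP[/andP[]]. Qed.

Lemma ord3_cases i : [\/ i = x, i = y | i = z].
Proof.
have : i \in [:: x; y; z].
  have [|_ h] := @uniq_min_size _ [:: x; y; z] (enum 'I_3) xyz (fun j _ => mem_enum 'I_3 j).
    by rewrite size_enum_ord.
  by rewrite h mem_enum.
by rewrite !inE => /or3P[]/eqP; [constructor 1|constructor 2|constructor 3].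
Qed.

Lemma big3 (R : Type) (idx : R) (op : Monoid.com_law idx) (G : 'I_3 -> R) :
  \big[op/idx]_i G i = op (G x) (op (G y) (G z)).
Proof.
have [xy xz yz] := neq_xyz.
rewrite (bigD1 x) //= (bigD1 y) 1?eq_sym //= (bigD1 z) 1?eq_sym ?xz 1?eq_sym ?yz //=.
rewrite big_pred0 ?Monoid.mulm1 // => i.
by case: (ord3_cases i) => ->; rewrite ?eqxx ?andbF ?andFb.
Qed.

(** Exponents, and below points, are given by their values at x, y and z, three
    distinct indices in no prescribed order: any coordinate can define the line at
    infinity. *)
Definition mnm3 (i j k : nat) : 'X_{1..3} :=
  [multinom if v == x then i else if v == y then j else k | v < 3].

Lemma mnm3x i j k : mnm3 i j k x = i. Proof. by rewrite mnmE eqxx. Qed.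
Lemma mnm3y i j k : mnm3 i j k y = j.
Proof. by have [xy _ _] := neq_xyz; rewrite mnmE eq_sym (negPf xy) eqxx. Qed.
Lemma mnm3z i j k : mnm3 i j k z = k.
Proof.
by have [_ xz yz] := neq_xyz; rewrite mnmE eq_sym (negPf xz) eq_sym (negPf yz).
Qed.

Lemma mnm3E (m : 'X_{1..3}) : m = mnm3 (m x) (m y) (m z).
Proof.
by apply/mnmP => i; case: (ord3_cases i) => ->; rewrite ?mnm3x ?mnm3y ?mnm3z.
Qed.

Lemma mdeg3 (m : 'X_{1..3}) : mdeg m = (m x + (m y + m z))%N.
Proof. by rewrite mdegE (big3 addn). Qed.

Definition point3 (a b c : K) (i : 'I_3) : K :=
  if i == x then a else if i == y then b else c.

Lemma point3E a b c : [/\ point3 a b c x = a, point3 a b c y = b & point3 a b c z = c].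
Proof.
have [xy xz yz] := neq_xyz.
by rewrite /point3 eqxx [y == x]eq_sym (negPf xy) eqxx [z == x]eq_sym (negPf xz) [z ==
  y]eq_sym (negPf yz).
Qed.

(** X_z = 1, the inner variable is X_x and the outer one X_y. *)
Definition dehomog_var (i : 'I_3) : T := if i == x then 'X%:P else if i == y then 'X else 1.
Definition dehomog (f : S) : T := mmap (polyC \o polyC) dehomog_var f.

HB.instance Definition _ := GRing.RMorphism.copy dehomog (mmap (polyC \o polyC)
  dehomog_var).

Lemma dehomogC c : dehomog c%:MP = c%:P%:P. Proof. exact: mmapC. Qed.

Lemma dehomogX i : dehomog 'X_i = dehomog_var i.
Proof. by rewrite /dehomog mmapX mmap1U. Qed.

Lemma dehomogD f g : dehomog (f + g) = dehomog f + dehomog g. Proof. exact: rmorphD. Qed.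
Lemma dehomogB f g : dehomog (f - g) = dehomog f - dehomog g. Proof. exact: rmorphB. Qed.
Lemma dehomogM f g : dehomog (f * g) = dehomog f * dehomog g. Proof. exact: rmorphM. Qed.

Lemma dehomog_varE : [/\ dehomog_var x = 'X%:P, dehomog_var y = 'X & dehomog_var z = 1].
Proof.
have [xy xz yz] := neq_xyz.
by rewrite /dehomog_var eqxx [y == x]eq_sym (negPf xy) eqxx [z == x]eq_sym (negPf xz) [z
  == y]eq_sym (negPf yz).
Qed.

Lemma eval2_dehomog a b f : eval2 a b (dehomog f) = f.@[point3 a b 1].
Proof.
elim/mpoly_closure_ind: f => [c|i|f g hf hg|f g hf hg].
- by rewrite dehomogC mevalC /eval2 !hornerC.
- rewrite dehomogX mevalXU /eval2; have [hx hy hz] := dehomog_varE;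
    have [px py pz] := point3E a b 1.
  by case: (ord3_cases i) => ->; rewrite ?hx ?hy ?hz ?px ?py ?pz !hornerE.
- by rewrite rmorphD eval2D hf hg mevalD.
- by rewrite rmorphM eval2M hf hg mevalM.
Qed.

Lemma dehomogXm (m : 'X_{1..3}) : dehomog 'X_[m] = ('X ^+ m x)%:P * 'X ^+ m y.
Proof.
rewrite /dehomog mmapX /mmap1 (big3 *%R) /=; have [-> -> ->] := dehomog_varE.
by rewrite expr1n mulr1 rmorphXn.
Qed.

Lemma coef_dehomog f i j :
  (dehomog f)`_j`_i = \sum_(m <- msupp f) f@_m * ((m x == i) && (m y == j))%:R.
Proof.
rewrite {1}[f]mpolyE raddf_sum /= coef_sum coef_sum; apply: eq_bigr => m _.
rewrite -mul_mpolyC rmorphM /= dehomogC dehomogXm !coefCM coefXn.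
rewrite mulr_natr coefMn coefXn eq_sym [j == _]eq_sym.
by case: (m y == j); case: (m x == i); rewrite ?mulr1n ?mulr0n ?mulr1 ?mulr0.
Qed.

Lemma dehomog_inj N f : f \is N.-homog -> dehomog f = 0 -> f = 0.
Proof.
move=> /dhomogP hf f0; apply/mpolyP => m; rewrite mcoeff0; apply/eqP.
apply: contraT; rewrite -mcoeff_msupp => ms.
have := coef_dehomog f (m x) (m y); rewrite f0 !coef0.
rewrite (bigD1_seq m) ?msupp_uniq //= !eqxx mulr1 big_seq_cond big1 ?addr0 =>
  [/esym/eqP|m'].
  by rewrite mcoeff_eq0 ms.
case/andP=> m's mm'; case: eqP => [ex|]; rewrite ?mulr0 //.
case: eqP => [ey|]; rewrite ?mulr0 //.
case/eqP: mm'; rewrite [m']mnm3E [m]mnm3E ex ey; congr (mnm3 _ _ _).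
have := hf _ m's; have /= <- := hf _ ms; rewrite /= !mdeg3 ex ey.
by do 2 move/addnI.
Qed.

Lemma dhomogXU i : ('X_i : S) \is 1.-homog.
Proof. by rewrite dhomogX /= mdeg1. Qed.

(** By structural induction: the degree can be raised by powers of X_z. *)
Lemma homogenize (u : T) : exists N0, forall N, (N0 <= N)%N ->
  exists2 U : S, U \is N.-homog & dehomog U = u.
Proof.
have hE := dehomog_varE; case: hE => hx hy hz.
pose H u := exists N0, forall N, (N0 <= N)%N ->
  exists2 U : S, U \is N.-homog & dehomog U = u.
have HD u1 u2 : H u1 -> H u2 -> H (u1 + u2).
  move=> [N1 h1] [N2 h2]; exists (maxn N1 N2) => N;
    rewrite geq_max => /andP[/h1[U1 d1 <-] /h2[U2 d2 <-]].
  by exists (U1 + U2); rewrite ?rmorphD // dhomogD.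
have HX i u1 : H u1 -> H (u1 * dehomog_var i).
  move=> [N1 h1]; exists N1.+1 => -[//|N] /h1[U1 d1 <-].
  exists (U1 * 'X_i); last by rewrite rmorphM /= dehomogX.
  by rewrite -[N.+1]addn1; apply: dhomogM => //; apply: dhomogXU.
have HC c : H c%:P%:P.
  exists 0%N => N _; exists (c%:MP * 'X_z ^+ N); last first.
    by rewrite rmorphM rmorphXn /= dehomogC dehomogX hz expr1n mulr1.
  rewrite mul_mpolyC; apply: dhomogZ; rewrite -[X in X.-homog]mul1n.
  by apply: dhomogMn; apply: dhomogXU.
have HP (c : {poly K}) : H c%:P.
  elim/poly_ind: c => [|c k IHc]; first by rewrite -(polyC0 K).
  by rewrite polyCD polyCM; apply: (HD) => //; rewrite -hx; apply: (HX).
suff : H u by [].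
elim/poly_ind: u => [|u c IH]; first by rewrite -(polyC0 {poly K}).
by apply: (HD) => //; rewrite -hy; apply: (HX).
Qed.

(** Restriction to the line X_z = 0, in the chart X_y = 1 of that line. *)
Definition restr_line_var (i : 'I_3) : {poly K} :=
  if i == x then 'X else if i == y then 1 else 0.
Definition restr_line (f : S) : {poly K} := mmap polyC restr_line_var f.

HB.instance Definition _ := GRing.RMorphism.copy restr_line (mmap polyC restr_line_var).

Lemma restr_lineXm (m : 'X_{1..3}) : restr_line 'X_[m] = (m z == 0%N)%:R * 'X ^+ m x.
Proof.
rewrite /restr_line mmapX /mmap1 (big3 *%R) /= /restr_line_var.
have [xy xz yz] := neq_xyz.
rewrite eqxx [y == x]eq_sym (negPf xy) eqxx [z == x]eq_sym (negPf xz) [z == y]eq_sym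
  (negPf yz).
by rewrite expr1n mul1r expr0n mulrC.
Qed.

Lemma restr_lineZ c f : restr_line (c *: f) = c *: restr_line f.
Proof. by rewrite /restr_line mmapZ mul_polyC. Qed.

Lemma restr_lineXz : restr_line 'X_z = 0.
Proof. by rewrite restr_lineXm mnm1E eqxx mul0r. Qed.

Lemma restr_line_horner t f : (restr_line f).[t] = f.@[point3 t 1 0].
Proof.
rewrite [f]mpolyE !raddf_sum /= horner_sum; apply: eq_bigr => m _.
rewrite restr_lineZ hornerZ mevalZ restr_lineXm mevalX (big3 *%R) /=.
have [-> -> ->] := point3E t 1 0; congr (_ * _).
by rewrite hornerM hornerXn expr1n mul1r expr0n mulrC -polyC_natr hornerC.
Qed.

Lemma coef_restr_line N f i : f \is N.-homog -> (i <= N)%N ->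
  (restr_line f)`_i = f@_(mnm3 i (N - i) 0).
Proof.
move=> /dhomogP hf iN.
rewrite {1}[f]mpolyE raddf_sum /= coef_sum.
have E m : m \in msupp f -> (restr_line (f@_m *: 'X_[m]))`_i =
  f@_m * (m == mnm3 i (N - i) 0)%:R.
  move=> /hf /= md; rewrite restr_lineZ coefZ restr_lineXm; congr (_ * _).
  rewrite -polyC_natr coefCM coefXn -natrM mulnb; congr (_%:R); congr nat_of_bool.
  apply/andP/eqP => [[/eqP mz /eqP mx]|->]; last by rewrite mnm3x mnm3z.
  rewrite [m]mnm3E -mx mz; congr (mnm3 _ _ _).
  by rewrite -md mdeg3 mz addn0 mx addKn.
rewrite (eq_big_seq _ E).
have [ms|ms] := boolP (mnm3 i (N - i) 0 \in msupp f).
  rewrite (bigD1_seq _ ms (msupp_uniq f)) /= eqxx mulr1 big1 ?addr0 // => m /negPf ->.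
  by rewrite mulr0.
rewrite (memN_msupp_eq0 ms) big_seq big1 // => m m'; case: eqP => [e|]; rewrite ?mulr0 //.
by rewrite -e m' in ms.
Qed.

Lemma size_restr_line N f : f \is N.-homog -> (size (restr_line f) <= N.+1)%N.
Proof.
move=> /dhomogP hf; rewrite [f]mpolyE raddf_sum /=.
rewrite big_seq; apply: (big_ind (fun p : {poly K} => (size p <= N.+1)%N)) =>
  [|p q hp hq|m /hf /= md].
- by rewrite size_poly0.
- by apply: leq_trans (size_polyD _ _) _; rewrite geq_max hp.
rewrite restr_lineZ; apply: leq_trans (size_scale_leq _ _) _; rewrite restr_lineXm.
rewrite -polyC_natr mul_polyC; apply: leq_trans (size_scale_leq _ _) _.
by rewrite size_polyXn ltnS -md mdeg3 leq_addr.
Qed.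

Lemma restr_line_surj N (w : {poly K}) : (size w <= N.+1)%N ->
  exists2 W : S, W \is N.-homog & restr_line W = w.
Proof.
move=> sw; exists (\sum_(i < N.+1) w`_i *: 'X_[mnm3 i (N - i) 0]).
  apply: rpred_sum => i _; apply: rpredZ; rewrite dhomogX /= mdeg3 mnm3x mnm3y mnm3z.
  by rewrite addn0 subnKC // -ltnS.
rewrite raddf_sum /= -[RHS](coefK w) poly_def.
rewrite (big_ord_widen N.+1 (fun i => w`_i *: 'X^i)) // [RHS]big_mkcond /=.
apply: eq_bigr => i _; rewrite restr_lineZ restr_lineXm mnm3z mnm3x eqxx mul1r.
by case: ltnP => // h; rewrite nth_default // scale0r.
Qed.

(** The degree N.-1 is right also for N = 0, since f is then 0. *)
Lemma restr_line_eq0 N f : f \is N.-homog -> restr_line f = 0 ->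
  exists2 f', f' \is (N.-1).-homog & f = 'X_z * f'.
Proof.
move=> hf f0.
have kf : kill [set z] f = 0.
  apply/mpolyP => m; rewrite mcoeff_kill mcoeff0; case: ifP => // /forall_inP/(_ z).
  rewrite inE eqxx => /(_ isT)/eqP mz.
  have [mN|mN] := eqVneq (mdeg m) N; last by apply: dhomog_nemf_coeff hf _.
  have mxN : (m x <= N)%N by rewrite -mN mdeg3 leq_addr.
  have := coef_restr_line hf mxN; rewrite f0 coef0 => ->; congr (f@_ _).
  by rewrite [LHS]mnm3E mz; congr (mnm3 _ _ _); rewrite -mN mdeg3 mz addn0 addKn.
have [g] := kill_sub [set z] f; rewrite kf subr0 big_set1 mulrC => fE.
have := pihomog_dE hf; rewrite {1}fE; case: N {hf} => [|N].
  by rewrite pihomog0_Xmul => <-; exists 0; rewrite ?mulr0 // dhomog0.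
by rewrite pihomog_Xmul => <-; exists (pihomog mdeg N (g z)); rewrite //= pihomogP.
Qed.

Lemma line_coprime f g : (forall v : 'I_3 -> K, v z = 0 -> f.@[v] = 0 -> g.@[v] = 0 ->
  v x = 0 /\ v y = 0) ->
  coprimep (restr_line f) (restr_line g).
Proof.
move=> nz; rewrite /coprimep; apply: contraT => /closed_rootP[t].
rewrite root_gcd /root !restr_line_horner => /andP[/eqP ft /eqP gt].
have [_ py pz] := point3E t 1 0.
have [_] := nz _ pz ft gt; rewrite py => /eqP; by rewrite oner_eq0.
Qed.

(** On the line X_z = 0, the relation U f + V g = 0 between coprime forms gives U =
    W g and V = - W f, with a form W; subtracting this trivial relation makes U and
    V multiples of X_z. That g does not vanish at (1, 0, 0) means that restr_line g
    keeps the degree of g, so that W is obtained with the right degree. *)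
Lemma zdivisor_aux d f g M U V H : f \is d.-homog -> g \is d.-homog ->
  coprimep (restr_line f) (restr_line g) -> g.@[point3 1 0 0] != 0 ->
  U \is M.-homog -> V \is M.-homog -> U * f + V * g = 'X_z * H ->
  exists U' V', [/\ U' \is (M.-1).-homog, V' \is (M.-1).-homog & H = U' * f + V' * g].
Proof.
move=> hf hg cop ge hU hV E.
have Epsi : restr_line U * restr_line f + restr_line V * restr_line g = 0.
  by rewrite -!rmorphM -rmorphD E rmorphM /= restr_lineXz mul0r.
have sg : size (restr_line g) = d.+1.
  apply/eqP; rewrite eqn_leq size_restr_line //=; rewrite ltnNge;
    apply/negP => /leq_sizeP/(_ d (leqnn d)).
  rewrite (coef_restr_line hg) // subnn => gd0; case/eqP: ge.
  rewrite [g]mpolyE raddf_sum /= big_seq big1 // => m ms;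
    rewrite mevalZ mevalX (big3 *%R) /=.
  have [-> -> ->] := point3E 1 0 0; rewrite expr1n mul1r !expr0n.
  case: eqP => [my|]; last by rewrite mul0r mulr0.
  case: eqP => [mz|]; last by rewrite mulr0 mulr0.
  have /dhomogP/(_ m ms) /= := hg; rewrite mdeg3 my mz !addn0 => mx.
  by rewrite [m]mnm3E my mz mx gd0 mul0r.
have g0 : restr_line g != 0 by rewrite -size_poly_eq0 sg.
have : restr_line g %| restr_line U.
  rewrite -(Gauss_dvdpl _ (q := restr_line f)); last by rewrite coprimep_sym.
  by rewrite (_ : _ * _ = - restr_line V * restr_line g) ?dvdp_mulIr // mulNr; apply/eqP;
    rewrite -addr_eq0 Epsi.
case/dvdpP=> w wE.
have [W [hW WE]] : exists W, (W * g \is M.-homog /\ W * f \is M.-homog) /\ restr_line W = w.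
  have [->|w0] := eqVneq w 0; first by exists 0; rewrite !mul0r dhomog0 rmorph0.
  have sw : (size w + d <= M.+1)%N.
    by have := size_restr_line hU; rewrite wE size_mul // sg addnS.
  have dM : (d <= M)%N.
    by rewrite -ltnS; apply: leq_trans sw; rewrite -{1}[d]add0n ltn_add2r size_poly_gt0.
  have [|W hW WE] := @restr_line_surj (M - d) w;
    first by rewrite -subSn // leq_subRL ?(leqW dM) // addnC.
  by exists W; split=> //; rewrite -(subnK dM); split; apply: dhomogM.
have [WgM WfM] := hW.
have [||U' hU' UE] := @restr_line_eq0 M (U - W * g).
- by rewrite rpredB.
- by rewrite rmorphB rmorphM /= WE wE subrr.
have [||V' hV' VE] := @restr_line_eq0 M (V + W * f).
- by rewrite rpredD.
- rewrite rmorphD rmorphM /= WE; apply: (mulIf g0); rewrite mul0r mulrDl.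
  by rewrite mulrAC -wE addrC.
exists U', V'; split=> //.
have Xz : 'X_z != 0 :> S by rewrite -msupp_eq0 msuppX.
apply: (mulfI Xz); rewrite -E mulrDr !mulrA -UE -VE; ring.
Qed.

(** One of f and g does not vanish at (1, 0, 0), a point of the line X_z = 0, and
    they play symmetric roles. *)
Lemma zdivisor d f g M U V H : f \is d.-homog -> g \is d.-homog ->
  (forall v : 'I_3 -> K, v z = 0 -> f.@[v] = 0 -> g.@[v] = 0 -> v x = 0 /\ v y = 0) ->
  U \is M.-homog -> V \is M.-homog -> U * f + V * g = 'X_z * H ->
  exists U' V', [/\ U' \is (M.-1).-homog, V' \is (M.-1).-homog & H = U' * f + V' * g].
Proof.
move=> hf hg nz hU hV E.
have cop := line_coprime nz.
have [g0|g0] := eqVneq (g.@[point3 1 0 0]) 0; last exact: (@zdivisor_aux d f g M U V).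
have [f0|f0] := eqVneq (f.@[point3 1 0 0]) 0.
  have [px _ pz] := point3E 1 0 0.
  by have [] := nz _ pz f0 g0; rewrite px => /eqP; rewrite oner_eq0.
have [||V' [U' [h1 h2 h3]]] := @zdivisor_aux d g f M V U H hg hf _ f0 hV hU.
- by rewrite coprimep_sym.
- by rewrite addrC.
by exists U', V'; split=> //; rewrite addrC.
Qed.

Lemma zdivisor_iter d f g k : f \is d.-homog -> g \is d.-homog ->
  (forall v : 'I_3 -> K, v z = 0 -> f.@[v] = 0 -> g.@[v] = 0 -> v x = 0 /\ v y = 0) ->
  forall M U V H, U \is M.-homog -> V \is M.-homog -> U * f + V * g = 'X_z ^+ k * H ->
  exists U' V', [/\ U' \is (M - k).-homog, V' \is (M - k).-homog & H = U' * f + V' * g].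
Proof.
move=> hf hg nz; elim: k => [|k IH] M U V H hU hV E.
  by exists U, V; rewrite subn0; split=> //; rewrite E expr0 mul1r.
rewrite exprS -mulrA in E.
have [U' [V' [hU' hV' E']]] := zdivisor hf hg nz hU hV E.
have [U2 [V2]] := IH _ _ _ _ hU' hV' (esym E').
by rewrite -subn1 -subnDA add1n; exists U2, V2.
Qed.

End Chart.

(** * Intersections of two plane curves *)

Section TwoPoints.
Variable K : closedFieldType.
Local Notation S := {mpoly K[3]}.
Implicit Types (f g : S) (v w : 'I_3 -> K).

Lemma complete_coordinates (z : 'I_3) : exists x y, uniq [:: x; y; z].
Proof.
case: z => [[|[|[|//]]] h].
- by exists (@Ordinal 3 1 isT), (@Ordinal 3 2 isT).
- by exists (@Ordinal 3 0 isT), (@Ordinal 3 2 isT).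
- by exists (@Ordinal 3 0 isT), (@Ordinal 3 1 isT).
Qed.

Definition nonzero v := exists i, v i != 0.

(** Independence of the gradients is transversality. If there were only one common
    zero, a linear form X_x - a0 X_z through it would lie in (f, g), all of whose
    elements have order at least d + 2. *)
Lemma two_common_zeros d f g :
  f \is (d.+2).-homog -> g \is (d.+2).-homog -> f != 0 -> g != 0 ->
  (forall v, nonzero v -> f.@[v] = 0 -> g.@[v] = 0 -> forall a b : K,
     (forall i, a * (f^`M(i)).@[v] + b * (g^`M(i)).@[v] = 0) -> a = 0 /\ b = 0) ->
  ~ (forall v w, nonzero v -> nonzero w -> f.@[v] = 0 -> g.@[v] = 0 ->
       f.@[w] = 0 -> g.@[w] = 0 -> exists c, forall i, v i = c * w i).
Proof.
move=> hf hg f0 g0 indep prop.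
(* P is the common zero, scaled to the chart; if there is none, any point will do. *)
have [z [P [Pz uniqP]]] : exists z (P : 'I_3 -> K), P z = 1 /\
    forall v, nonzero v -> f.@[v] = 0 -> g.@[v] = 0 -> exists c, forall i, v i = c * P i.
  have [[w [wn fw gw]]|nw] := pselect (exists w, [/\ nonzero w, f.@[w] = 0 & g.@[w] = 0]).
    have [z wz] := wn; exists z, (fun i => w i / w z); split; first by rewrite divff.
    move=> v vn fv gv; have [c hc] := prop v w vn wn fv gv fw gw.
    by exists (c * w z) => i; rewrite hc -mulrA [w z * _]mulrC divfK.
  exists 0, (fun i => (i == 0)%:R); split=> // v vn fv gv.
  by case: nw; exists v.
have [x [y xyz]] := complete_coordinates z.
set a0 := P x; set b0 := P y; pose Q := point3 x y a0 b0 1.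
have [Qx Qy Qz] := point3E xyz a0 b0 1; rewrite -/Q in Qx Qy Qz.
have Qn : nonzero Q by exists z; rewrite Qz oner_neq0.
have [hx hy hz] := @dehomog_varE K x y z xyz.
have sum3 (V : zmodType) (G : 'I_3 -> V) : \sum_i G i = G x + (G y + G z).
  exact: (big3 xyz +%R).
have [||a b fa ga|fQ gQ|U [V E]] :=
  @simple_zero_in_ideal K (dehomog x y f) (dehomog x y g) a0 b0.
- by apply: contra_neq f0 => /(dehomog_inj xyz hf).
- by apply: contra_neq g0 => /(dehomog_inj xyz hg).
- rewrite !(eval2_dehomog xyz) in fa ga.
  have [px py pz] := point3E xyz a b 1.
  have [|c hc] := uniqP (point3 x y a b 1) _ fa ga; first by exists z; rewrite pz oner_neq0.
  have c1 : c = 1 by have := hc z; rewrite pz Pz mulr1 => <-.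
  by split; [have := hc x; rewrite px|have := hc y; rewrite py]; rewrite c1 mul1r.
- rewrite !(eval2_dehomog xyz) -/Q in fQ gQ.
  have [u hu] := mpoly_taylor1 Q f; have [w hw] := mpoly_taylor1 Q g.
  have expand h (t : 'I_3 -> S) : h.@[Q] = 0 ->
      h = (h.@[Q])%:MP + \sum_i t i * ('X_i - (Q i)%:MP) ->
      dehomog x y h = ('X - a0%:P)%:P * dehomog x y (t x) + ('X - b0%:P%:P) * dehomog x y
        (t y).
    move=> hQ {1}->; rewrite hQ mpolyC0 add0r sum3 Qx Qy Qz 2!dehomogD 3!dehomogM
      3!dehomogB.
    rewrite 3!dehomogX 3!dehomogC hx hy hz (polyC1 K) (polyC1 {poly K}) subrr mulr0 addr0.
    by rewrite [dehomog x y (t x) * _]mulrC [dehomog x y (t y) * _]mulrC polyCB.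
  exists (dehomog x y (u x)), (dehomog x y (u y)), (dehomog x y (w x)),
    (dehomog x y (w y)); split.
  + exact: expand.
  + exact: expand.
  rewrite eval2D eval2N !eval2M !(eval2_dehomog xyz) -/Q -!(mderiv_taylor1 _ hu)
    -!(mderiv_taylor1 _ hw).
  set fx := (f^`M(x)).@[Q]; set fy := (f^`M(y)).@[Q].
  set gx := (g^`M(x)).@[Q]; set gy := (g^`M(y)).@[Q].
  apply/eqP => det0.
  (* By Euler's formula, the derivatives along x and y determine the gradient at Q. *)
  have eulerz h : h \is (d.+2).-homog -> h.@[Q] = 0 ->
      (h^`M(z)).@[Q] = - (a0 * (h^`M(x)).@[Q] + b0 * (h^`M(y)).@[Q]).
    move=> hh hQ; have := euler Q hh; rewrite hQ mulr0 sum3 Qx Qy Qz mul1r => e.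
    by apply/eqP; rewrite eq_sym -subr_eq0 -opprD oppr_eq0 -addrA e.
  have dep a b : a * fx + b * gx = 0 -> a * fy + b * gy = 0 -> a = 0 /\ b = 0.
    move=> ex ey; apply: (indep Q Qn fQ gQ) => i; case: (ord3_cases xyz i) => -> //.
    rewrite !eulerz // -/fx -/fy -/gx -/gy.
    have -> : a * - (a0 * fx + b0 * fy) + b * - (a0 * gx + b0 * gy) =
       - (a0 * (a * fx + b * gx) + b0 * (a * fy + b * gy)) by ring.
    by rewrite ex ey !mulr0 addr0 oppr0.
  have [gx0 fx0] : gx = 0 /\ - fx = 0.
    apply: dep; first by ring.
    by rewrite -[RHS]oppr0 -det0; ring.
  have [gy0 fy0] : gy = 0 /\ - fy = 0.
    apply: dep; last by ring.
    by rewrite -[RHS]det0; ring.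
  have [] : (1 : K) = 0 /\ (1 : K) = 0.
    apply: dep; rewrite ?gx0 ?gy0 ?mulr0 ?addr0 mul1r; apply/eqP.
      by rewrite -oppr_eq0 fx0.
    by rewrite -oppr_eq0 fy0.
  by move/eqP; rewrite oner_eq0.
have [N1 hN1] := homogenize xyz U; have [N2 hN2] := homogenize xyz V.
pose N := maxn N1 N2.
have [U' hU' UE] := hN1 N (leq_maxl _ _); have [V' hV' VE] := hN2 N (leq_maxr _ _).
have Xh i : ('X_i : S) \is 1.-homog by apply: dhomogXU.
pose ell : S := 'X_x - a0 *: 'X_z.
have hell : ell \is 1.-homog by rewrite rpredB ?rpredZ.
have EQ : U' * f + V' * g = 'X_z ^+ (N + d.+1) * ell.
  apply/eqP; rewrite -subr_eq0; apply/eqP.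
  apply: (@dehomog_inj _ _ _ _ xyz (N + d.+2)).
    rewrite rpredB //; first by rewrite rpredD //; apply: dhomogM.
    rewrite (_ : (N + d.+2 = (N + d.+1) + 1)%N); last by rewrite addn1 addnS.
    apply: dhomogM => //; rewrite -[X in X.-homog]mul1n.
    exact: dhomogMn.
  rewrite dehomogB dehomogD 3!dehomogM UE VE -E rmorphXn /= dehomogX hz expr1n mul1r.
  by rewrite dehomogB -mul_mpolyC dehomogM 2!dehomogX dehomogC hx hz mulr1 polyCB subrr.
have nz v : v z = 0 -> f.@[v] = 0 -> g.@[v] = 0 -> v x = 0 /\ v y = 0.
  move=> vz fv gv; suff h i : v i = 0 by split; apply: h.
  apply/eqP; apply: contraT => vi.
  have [|c hc] := uniqP v _ fv gv; first by exists i.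
  have := hc z; rewrite vz Pz mulr1 => c0; by rewrite hc -c0 mul0r eqxx in vi.
have [U2 [V2 [hU2 hV2 E2]]] := zdivisor_iter xyz hf hg nz hU' hV' EQ.
rewrite (_ : (N - _ = 0)%N) in hU2 hV2; last by apply/eqP; rewrite subn_eq0 leq_addr.
have ell0 : ell != 0.
  apply/eqP => /(congr1 (mcoeff U_(x)%MM)).
  have [_ xz _] := neq_xyz xyz.
  rewrite mcoeff0 mcoeffB mcoeffZ !mcoeffX eqxx eq_mnm1 [z == x]eq_sym (negPf xz) mulr0
    subr0.
  by move/eqP; rewrite oner_eq0.
suff : 1%N = d.+2 by [].
apply: (dhomog_uniq ell0 hell); rewrite E2 -[d.+2]add0n.
by rewrite rpredD //; apply: dhomogM.
Qed.

End TwoPoints.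

Section Arrangement.
Variable K : closedFieldType.
Local Notation S := {mpoly K[3]}.
Implicit Types (f g : S) (p q : proj_plane K) (v w : 'rV[K]_3).

Lemma proj_pointP v : v != 0 -> exists p, val p = <[v]>%VS.
Proof.
by move=> v0; have d1 : \dim <[v]> == 1%N;
  [rewrite dim_vline v0 | exists (exist _ <[v]>%VS d1)].
Qed.

Lemma proj_gen p : exists2 v, v != 0 & val p = <[v]>%VS.
Proof.
have /eqP dp := valP p; exists (vpick (val p)); first by rewrite vpick0 -dimv_eq0 dp.
apply/eqP; rewrite eq_sym eqEdim -memvE memv_pick dp dim_vline.
by rewrite vpick0 -dimv_eq0 dp.
Qed.

Lemma homog_scale d f c v : f \is d.-homog -> f.@[(c *: v) 0] = c ^+ d * f.@[v 0].
Proof.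
move=> hf; rewrite -(meval_scale c (v 0) hf); apply: meval_eq => i; by rewrite mxE.
Qed.

Lemma on_curve_gen d f p v : f \is d.-homog -> val p = <[v]>%VS ->
  on_curve f p <-> f.@[v 0] = 0.
Proof.
move=> hf pv; split=> [|fv w]; first by apply; rewrite pv memv_line.
by rewrite pv => /vlineP[c ->]; rewrite (homog_scale c v hf) fv mulr0.
Qed.

Lemma nonzero_row v : v != 0 <-> nonzero (v 0).
Proof.
split=> [/rV0Pn[i vi]|[i vi]]; first by exists i.
by apply/rV0Pn; exists i.
Qed.

Lemma proj_eq p q v w : val p = <[v]>%VS -> val q = <[w]>%VS -> p <> q ->
  w != 0 -> ~ exists c, v = c *: w.
Proof.
move=> pv qw pq w0 [c vc]; apply: pq; apply: val_inj.
have dv : \dim (val p) = \dim (val q) by have /eqP -> := valP p; have /eqP -> := valP q.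
apply/eqP; rewrite eqEdim dv leqnn andbT pv qw -memvE vc.
by apply: memvZ; rewrite memv_line.
Qed.

(** Proportional nonzero gradients at v are proportional on the whole line of v, by
    homogeneity, hence define the same tangent line. *)
Lemma gradient_independent d f g p v : smooth_curve d.+1 f -> smooth_curve d.+1 g ->
  val p = <[v]>%VS -> v != 0 -> on_curve f p -> on_curve g p ->
  ~ same_tangent f g p -> forall a b : K,
     (forall i, a * (f^`M(i)).@[v 0] + b * (g^`M(i)).@[v 0] = 0) -> a = 0 /\ b = 0.
Proof.
move=> [_ hf smf] [_ hg smg] pv v0 fp gp nt a b dep.
have vp : v \in val p by rewrite pv memv_line.
have [i fi] := smf p fp v vp v0; have [j gj] := smg p gp v vp v0.
have [a0|a0] := eqVneq a 0.
  split=> //; have := dep j; rewrite a0 mul0r add0r => /eqP.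
  by rewrite mulf_eq0 (negPf gj) orbF => /eqP.
have [b0|b0] := eqVneq b 0.
  split=> //; have := dep i; rewrite b0 mul0r addr0 => /eqP.
  by rewrite mulf_eq0 (negPf fi) orbF => /eqP.
case: nt => q.
have prop c w : b * \sum_(k < 3) (g^`M(k)).@[(c *: v) 0] * w 0 k =
    - a * \sum_(k < 3) (f^`M(k)).@[(c *: v) 0] * w 0 k.
  rewrite !mulr_sumr; apply: eq_bigr => k _; rewrite !mulrA; congr (_ * _).
  rewrite (homog_scale c v (mderiv_homog k hf)) (homog_scale c v (mderiv_homog k hg)).
  apply/eqP; rewrite mulNr -subr_eq0 opprK !(mulrCA _ (c ^+ d)) -mulrDr addrC dep.
  by rewrite mulr0.
split=> h u w; rewrite pv => /vlineP[c ->] wq; apply/eqP.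
  have := prop c w; rewrite h ?mulr0 //; last by rewrite pv; apply/vlineP; exists c.
  by move/eqP; rewrite mulf_eq0 (negPf b0).
have := prop c w; rewrite h ?mulr0 //; last by rewrite pv; apply/vlineP; exists c.
by move/esym/eqP; rewrite mulf_eq0 oppr_eq0 (negPf a0).
Qed.

Definition form_col f : 'cV[K]_3 := \col_i f@_U_(i)%MM.

Lemma linear_form f v : f \is 1.-homog -> f.@[v 0] = (v *m form_col f) 0 0.
Proof.
move=> /dhomogP hf; rewrite mxE.
have -> : f = \sum_i f@_U_(i)%MM *: 'X_i.
  apply/mpolyP => m; rewrite raddf_sum /=.
  have [/eqP/mdeg1P[i /eqP mi]|m1] := eqVneq (mdeg m) 1%N.
    rewrite (bigD1 i) //= mcoeffZ mcoeffX mi eqxx mulr1 big1 ?addr0 // => j ji.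
    by rewrite mcoeffZ mcoeffX eq_mnm1 (negPf ji) mulr0.
  rewrite big1 => [|j _].
    by apply/eqP; rewrite mcoeff_eq0; apply: contra m1 => /hf /= ->.
  rewrite mcoeffZ mcoeffX; case: eqP => [e|]; rewrite ?mulr0 //.
  by rewrite -e mdeg1 in m1.
rewrite raddf_sum /=; apply: eq_bigr => i _.
rewrite mevalZ mevalXU mxE mulrC; congr (_ * _).
rewrite raddf_sum /= (bigD1 i) //= mcoeffZ mcoeffX eqxx mulr1 big1 ?addr0 // => j ji.
by rewrite mcoeffZ mcoeffX eq_mnm1 (negPf ji) mulr0.
Qed.

(** Two linear equations in three unknowns have a nonzero solution. *)
Lemma lines_meet f g : f \is 1.-homog -> g \is 1.-homog ->
  exists p, on_curve f p /\ on_curve g p.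
Proof.
move=> hf hg; pose M : 'M_(3, 1 + 1) := row_mx (form_col f) (form_col g).
have kM : kermx M != 0.
  by rewrite -mxrank_eq0 mxrank_ker -lt0n subn_gt0 (leq_ltn_trans (rank_leq_col _)).
have v0 : nz_row (kermx M) != 0 by rewrite nz_row_eq0.
have /sub_kermxP : (nz_row (kermx M) <= kermx M)%MS by apply: nz_row_sub.
set v := nz_row _ in v0 *; rewrite /M mul_mx_row => vM.
have [p pv] := proj_pointP v0; exists p.
have e1 : v *m form_col f = 0.
  by have := congr1 lsubmx vM; rewrite row_mxKl linear0.
have e2 : v *m form_col g = 0.
  by have := congr1 rsubmx vM; rewrite row_mxKr linear0.
by rewrite (on_curve_gen hf pv) (on_curve_gen hg pv) !linear_form // e1 e2 mxE.
Qed.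

(** Two forms vanishing at two independent vectors have proportional coefficients,
    hence the same zeros. *)
Lemma lines_meet_once f g p q : smooth_curve 1 f -> smooth_curve 1 g -> ~ same_curve f g ->
  on_curve f p -> on_curve g p -> on_curve f q -> on_curve g q -> p = q.
Proof.
move=> [f0 hf _] [g0 hg _] fg fp gp fq gq; apply: contrapT => pq.
have [v v0 pv] := proj_gen p; have [w w0 qw] := proj_gen q.
have nvw := proj_eq pv qw pq w0.
have lin (h : S) (u : 'rV[K]_3) : h \is 1.-homog -> h.@[u 0] = 0 -> u *m form_col h = 0.
  by move=> hh; rewrite linear_form // => e; apply/matrixP => i j; rewrite !ord1 e mxE.
pose M : 'M_(1 + 1, 3) := col_mx v w.
have rM : \rank M = 2%N.
  apply/eqP; rewrite eqn_leq rank_leq_row /= ltnNge; apply/negP => r1.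
  have wM : (w <= M)%MS by rewrite /M -addsmxE addsmxSr.
  have vM : (v <= M)%MS by rewrite /M -addsmxE addsmxSl.
  have rw : \rank w = 1%N by rewrite rank_rV w0.
  have [le eqr] := mxrank_leqif_eq wM.
  have : \rank w == \rank M by rewrite eqn_leq le rw r1.
  rewrite eqr => /eqmxP wE.
  by apply: nvw; apply/sub_rVP; rewrite wE.
have kM (h : S) : h \is 1.-homog -> on_curve h p -> on_curve h q -> M *m form_col h = 0.
  move=> hh hp hq; rewrite /M mul_col_mx !lin ?col_mx0 //.
    exact/(on_curve_gen hh qw).
  exact/(on_curve_gen hh pv).
have col0 (h : S) : h != 0 -> h \is 1.-homog -> form_col h != 0.
  move=> h0 hh; apply: contra_neq h0 => e; apply/mpolyP => m; rewrite mcoeff0.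
  have [/eqP/mdeg1P[i /eqP ->]|m1] := eqVneq (mdeg m) 1%N.
    by have := congr1 (fun x : 'cV_3 => x i 0) e; rewrite !mxE.
  exact: dhomog_nemf_coeff hh _.
have prop (f1 g1 : S) : f1 != 0 -> f1 \is 1.-homog -> g1 \is 1.-homog ->
    M *m form_col f1 = 0 -> M *m form_col g1 = 0 ->
      exists c, form_col g1 = c *: form_col f1.
  move=> f10 hf1 hg1 e1 e2.
  pose N : 'M[K]_(1 + 1, 3) := col_mx (form_col f1)^T (form_col g1)^T.
  have NM : N *m M^T = 0.
    by rewrite mul_col_mx -!trmx_mul e1 e2 !trmx0 col_mx0.
  have rN : (\rank N <= 1)%N.
    have /sub_kermxP/mxrankS := NM; rewrite mxrank_ker mxrank_tr rM; exact.
  have fN : ((form_col f1)^T <= N)%MS by rewrite /N -addsmxE addsmxSl.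
  have gN : ((form_col g1)^T <= N)%MS by rewrite /N -addsmxE addsmxSr.
  have rf : \rank (form_col f1)^T = 1%N by rewrite rank_rV -trmx0 (inj_eq trmx_inj) col0.
  have [le eqr] := mxrank_leqif_eq fN.
  have : \rank (form_col f1)^T == \rank N by rewrite eqn_leq le rf rN.
  rewrite eqr => /eqmxP fE.
  move: gN; rewrite -fE => /sub_rVP[c hc]; exists c.
  by apply: trmx_inj; rewrite hc linearZ.
have sub (f1 g1 : S) : f1 != 0 -> f1 \is 1.-homog -> g1 \is 1.-homog ->
    M *m form_col f1 = 0 -> M *m form_col g1 = 0 -> forall r, on_curve f1 r ->
      on_curve g1 r.
  move=> h1 h2 h3 h4 h5 r; have [u _ ru] := proj_gen r.
  have [c hc] := prop f1 g1 h1 h2 h3 h4 h5.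
  rewrite (on_curve_gen h2 ru) (on_curve_gen h3 ru) !linear_form // hc => e.
  by rewrite -scalemxAr mxE e mulr0.
by apply: fg => r; split; apply: sub => //; apply: kM.
Qed.

Lemma curves_meet_twice d f g : smooth_curve d.+2 f -> smooth_curve d.+2 g ->
  (forall p, on_curve f p -> on_curve g p -> ~ same_tangent f g p) ->
  exists p q, [/\ p <> q, on_curve f p, on_curve g p, on_curve f q & on_curve g q].
Proof.
move=> smf smg nt; apply: contrapT => np.
have [f0 hf _] := smf; have [g0 hg _] := smg.
have row (v : 'I_3 -> K) : exists r : 'rV[K]_3, r 0 = v.
  by exists (\row_i v i); apply/funext => i; rewrite mxE.
apply: (two_common_zeros hf hg f0 g0) => [v vn fv gv|v w vn wn fv gv fw gw].
  have [r rv] := row v; rewrite -{}rv in vn fv gv *.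
  have r0 : r != 0 by apply/nonzero_row.
  have [p pr] := proj_pointP r0.
  have fp : on_curve f p by apply/(on_curve_gen hf pr).
  have gp : on_curve g p by apply/(on_curve_gen hg pr).
  exact: (gradient_independent smf smg pr r0 fp gp (nt p fp gp)).
have [r rv] := row v; have [t tw] := row w; rewrite -{}rv -{}tw in vn fv gv wn fw gw *.
have r0 : r != 0 by apply/nonzero_row.
have t0 : t != 0 by apply/nonzero_row.
have [p pr] := proj_pointP r0; have [q qt] := proj_pointP t0.
have pq : p = q.
  apply: contrapT => pq; apply: np; exists p, q; split=> //.
  - exact/(on_curve_gen hf pr).
  - exact/(on_curve_gen hg pr).
  - exact/(on_curve_gen hf qt).
  - exact/(on_curve_gen hg qt).
have : r \in <[t]>%VS by rewrite -qt -pq pr memv_line.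
by case/vlineP=> c ->; exists c => i; rewrite mxE.
Qed.

End Arrangement.

(** * Levi graphs of arrangements *)

Section Levi.
Variables (K : closedFieldType) (d k s : nat).
Variables (C : 'I_k -> {mpoly K[3]}) (p : 'I_s -> proj_plane K).
Hypothesis arr : d_arrangement d C.
Hypothesis injp : injective p.
Hypothesis hp : forall q, intersection_point C q <-> exists j, p j = q.
Local Notation e := (levi_graph C p).

Lemma levi_lr j i : e (lshift k j) (rshift s i) = `[< on_curve (C i) (p j) >].
Proof.
by rewrite /levi_graph -[lshift k j]/(unsplit (inl j)) -[rshift s i]/(unsplit (inr i))
  !unsplitK.
Qed.

Lemma levi_rl j i : e (rshift s i) (lshift k j) = `[< on_curve (C i) (p j) >].
Proof.
by rewrite /levi_graph -[lshift k j]/(unsplit (inl j)) -[rshift s i]/(unsplit (inr i))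
  !unsplitK.
Qed.

Lemma levi_ll j j' : e (lshift k j) (lshift k j') = false.
Proof.
by rewrite /levi_graph -[lshift k j]/(unsplit (inl j)) -[lshift k j']/(unsplit (inl j'))
  !unsplitK.
Qed.

Lemma levi_rr i i' : e (rshift s i) (rshift s i') = false.
Proof.
by rewrite /levi_graph -[rshift s i]/(unsplit (inr i)) -[rshift s i']/(unsplit (inr i'))
  !unsplitK.
Qed.

Lemma vertex_cases u : (exists j, u = lshift k j) \/ (exists i, u = rshift s i).
Proof. by rewrite -(splitK u); case: (split u) => [j|i]; [left; exists j|right;
  exists i]. Qed.

Lemma other_curve i : exists i' : 'I_k, i != i'.
Proof.
have k3 := arr_size arr; have k0 : (0 < k)%N by apply: leq_trans k3.
have k1 : (1 < k)%N by apply: leq_trans k3.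
have [e0|ne] := eqVneq i (Ordinal k0); last by exists (Ordinal k0).
by exists (Ordinal k1); rewrite e0.
Qed.

Lemma meeting_point i i' q : i != i' -> on_curve (C i) q -> on_curve (C i') q ->
  exists j, p j = q.
Proof. by move=> ii' h h'; apply/hp; exists i, i'. Qed.

(** In degree 1, if all the intersection points on a line coincide, then all the
    other lines pass through this point, since each of them meets the line. *)
Lemma two_points_on_curve i : ~ (d = 1%N /\ exists q, forall i, on_curve (C i) q) ->
  exists j j', [/\ j != j', on_curve (C i) (p j) & on_curve (C i) (p j')].
Proof.
move=> npencil; have smooth := arr_smooth arr.
have [i' ii'] := other_curve i.
have [d1|d1] := eqVneq d 1%N.
  apply: contrapT => one; apply: npencil; split=> //.
  have hom i1 : C i1 \is 1.-homog by case: (smooth i1); rewrite d1.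
  have [q [qi qi']] := lines_meet (hom i) (hom i').
  have [j pj] := meeting_point ii' qi qi'.
  exists q => i2; have [<- //|ii2] := eqVneq i i2.
  have [q2 [q2i q2i2]] := lines_meet (hom i) (hom i2).
  have [j2 pj2] := meeting_point ii2 q2i q2i2.
  have [jj2|jj2] := eqVneq j j2; first by rewrite -pj jj2 pj2.
  by case: one; exists j, j2; rewrite pj pj2.
have [d' dE] : exists d', d = d'.+2.
  by have := arr_degree arr; case: (d) d1 => [|[|d']] // _ _; exists d'.
have [|q [q' [qq' qi qi' q'i q'i']]] :=
    @curves_meet_twice K d' (C i) (C i') (ltac:(rewrite -dE;
      exact: smooth)) (ltac:(rewrite -dE; exact: smooth)).
  move=> q qi qi'; apply: (arr_ordinary arr) => //; by exists i, i'.
have [j pj] := meeting_point ii' qi qi'; have [j' pj'] := meeting_point ii' q'i q'i'.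
exists j, j'; rewrite pj pj'; split=> //; apply: contra_notN qq' => /eqP jj'.
by rewrite -pj -pj' jj'.
Qed.

Variable F : fieldType.

(** Otherwise every vertex of the Levi graph has two neighbours, so either side can
    play the role of A in [leafless_not_SCM]: the smaller one does. *)
Lemma SCM_pencil : sequentially_CM (edge_grading F e) ->
  d = 1%N /\ exists q, forall i, on_curve (C i) q.
Proof.
move=> scm; apply: contrapT => npencil.
have k0 : (0 < k)%N by apply: leq_trans (arr_size arr).
have [j0 _] := two_points_on_curve (Ordinal k0) npencil.
pose X : {set 'I_(s + k)} := [set u | if split u is inl _ then true else false].
have Xl j : lshift k j \in X.
  by rewrite inE -[lshift k j]/(unsplit (inl j)) unsplitK.
have Xr i : (rshift s i \in X) = false.
  by rewrite inE -[rshift s i]/(unsplit (inr i)) unsplitK.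
have bip u v : e u v -> (u \in X) != (v \in X).
  case: (vertex_cases u) => -[a ->]; case: (vertex_cases v) => -[b ->];
  by rewrite ?levi_ll ?levi_rr ?Xl ?Xr.
have [cX|cX] := leqP #|X| #|~: X|.
  apply: (leafless_not_SCM (A := X) _ _ cX _ scm) => //.
    move=> b; case: (vertex_cases b) => -[i ->]; first by rewrite Xl.
    have [j [j' [jj' ij ij']]] := two_points_on_curve i npencil.
    move=> _; exists (lshift k j), (lshift k j'); rewrite !Xl !levi_lr eq_lshift.
    by split=> //; apply/asboolP.
  by apply/card_gt0P; exists (rshift s (Ordinal k0)); rewrite inE Xr.
apply: (leafless_not_SCM (A := ~: X) _ _ _ _ scm).
- by move=> u v /bip; rewrite !in_setC; case: (u \in X); case: (v \in X).
- move=> b; rewrite in_setC negbK; case: (vertex_cases b) => -[j ->]; last by rewrite Xr.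
  move=> _; have /hp[i [i' [ii' ij i'j]]] : exists j', p j' = p j by exists j.
  exists (rshift s i), (rshift s i'); rewrite !in_setC !Xr !levi_rl eq_rshift.
  by split=> //; apply/asboolP.
- by rewrite setCK ltnW.
- by rewrite setCK; apply/card_gt0P; exists (lshift k j0).
Qed.

(** All the intersection points coincide, as two distinct lines meet only once; so
    the Levi graph is a star centred at this point. *)
Lemma pencil_SCM q : d = 1%N -> (forall i, on_curve (C i) q) ->
  sequentially_CM (edge_grading F e).
Proof.
move=> d1 hq; have k3 := arr_size arr.
have k0 : (0 < k)%N by apply: leq_trans k3.
have [i0' i00'] := other_curve (Ordinal k0).
have [j0 pj0] := meeting_point i00' (hq _) (hq _).
have one j : j = j0.
  apply: injp; rewrite pj0; have /hp[i [i' [ii' ij i'j]]] : exists j',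
    p j' = p j by exists j.
  have sm i1 : smooth_curve 1 (C i1) by rewrite -d1; apply: (arr_smooth arr).
  exact: (lines_meet_once (sm i) (sm i') (arr_distinct arr ii')).
apply: (@star_SCM _ F e (lshift k j0)); last first.
  rewrite cardsC1 card_ord -subn1 ltn_subRL; apply: leq_trans (leq_addl _ _).
  exact: k3.
move=> u v; case: (vertex_cases u) => -[a ->]; case: (vertex_cases v) => -[b ->];
  rewrite ?levi_ll ?levi_lr ?levi_rl ?levi_rr ?(one a) ?(one b) ?eqxx //=.
- by rewrite eq_rlshift pj0 /=; apply/asboolP/hq.
- by rewrite eq_rlshift pj0 /=; apply/asboolP/hq.
- by rewrite !eq_rlshift.
Qed.

End Levi.

Theorem theorem6p5 (R : realType) (d k s : nat)
    (C : 'I_k -> {mpoly R[i][3]}) (p : 'I_s -> proj_plane R[i])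
    (F : fieldType) :
  d_arrangement d C ->
  injective p ->
  (forall q, intersection_point C q <-> exists j, p j = q) ->
  (sequentially_CM (edge_grading F (levi_graph C p)) <->
  (d = 1%N /\ exists q, forall i, on_curve (C i) q)).
Proof.
move=> arr injp hp; split=> [|[d1 [q hq]]]; first exact: SCM_pencil.
exact: (pencil_SCM arr injp hp F d1 hq).
Qed.
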